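(* Let $\Omega=\bigcup_{i=1}^n(\alpha_i,\beta_i)$ with $-\infty<\alpha_1<\beta_1<\alpha_2<\beta_2<\dots<\alpha_n<\beta_n<\infty$. For $\lambda=(\lambda_1,\dots,\lambda_n)\in\mathbb{R}^n$ define the $n\times n$ matrices $$M_{\alpha,\lambda}=\frac1{\sqrt n}\left(e^{2\pi \mathrm{i}\alpha_i\lambda_j}\right)_{i,j=1}^n,\qquad M_{\beta,\lambda}=\frac1{\sqrt n}\left(e^{2\pi \mathrm{i}\beta_i\lambda_j}\right)_{i,j=1}^n.$$ The set $\Omega$ is spectral if and only if there exist points $\lambda_1,\dots,\lambda_n$ in $\mathbb{R}$ such that, with $\lambda=(\lambda_1,\dots,\lambda_n)$, $M_{\alpha,\lambda}$ is non-singular and the matrix $B=M_{\beta,\lambda}M_{\alpha,\lambda}^{-1}$ is a spectral unitary matrix for $\Omega$.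
   Context: $\mathrm{i}$ (upright) is the imaginary unit. $\Omega$ is spectral if there is $\Lambda\subset\mathbb{R}$ such that $\{|\Omega|^{-1/2}e_\lambda:\lambda\in\Lambda\}$ is an orthonormal basis of $L^2(\Omega)$, where $e_\lambda(x)=e^{2\pi \mathrm{i}\lambda x}$. For $v\in\mathbb{C}^n$, $E(v)$ is the diagonal matrix with entries $e^{v_1},\dots,e^{v_n}$; $\alpha=(\alpha_1,\dots,\alpha_n)$, $\beta=(\beta_1,\dots,\beta_n)$, $\mathbf{1}=(1,\dots,1)\in\mathbb{C}^n$. An $n\times n$ unitary matrix $B$ is called spectral for $\Omega$ if for every $\mu\in\mathbb{C}$, $\ker(I-E(-2\pi \mathrm{i}\mu\beta)BE(2\pi \mathrm{i}\mu\alpha))$ is either $\{0\}$ or $\mathbb{C}\mathbf{1}$. *)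

(* Defs.v *)
From HB Require Import structures.
From mathcomp Require Import all_boot all_order all_algebra.
From mathcomp Require Import complex.
From mathcomp Require Import all_classical all_reals all_analysis.

Set Implicit Arguments.
Unset Strict Implicit.
Unset Printing Implicit Defensive.

Import Order.TTheory GRing.Theory Num.Theory.
Import numFieldNormedType.Exports.

Local Open Scope classical_set_scope.
Local Open Scope complex_scope.
Local Open Scope ring_scope.

Section ComplexL2.
Variable R : realType.
Implicit Types (D : set R) (f g : R -> R[i]).

Definition cexp (z : R[i]) : R[i] :=
  (expR (complex.Re z))%:C * (cos (complex.Im z) +i* sin (complex.Im z)).

Definition two_pi_i : R[i] := 0 +i* (2 * pi).

(* The norm of R[i] is R[i]-valued; complex.Re casts it back to R. *)
Definition cmodulus (z : R[i]) : R := complex.Re `|z|.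

(* 'N[_]_2 is the library's norm for functions on the whole line, so |f| is
   extended by 0 outside D. *)
Definition L2norm D f : \bar R :=
  ('N[@lebesgue_measure R]_(2%:E) [EFin \o ((cmodulus \o f) \_ D)])%E.

(* Elements of L^2(D) are represented by functions; only their values on D
   are used, and equality almost everywhere is distance 0 for L2norm. *)
Definition inL2 D f : Prop :=
  [/\ measurable_fun D (fun x => complex.Re (f x)),
      measurable_fun D (fun x => complex.Im (f x)) &
      (L2norm D f < +oo)%E].

Definition cintegral D f : R[i] :=
  (\int[@lebesgue_measure R]_(x in D) complex.Re (f x)) +i*
  (\int[@lebesgue_measure R]_(x in D) complex.Im (f x)).

Definition L2inner D f g : R[i] := cintegral D (fun x => f x * (g x)^*).

Definition L2orthonormal D (S : set (R -> R[i])) : Prop :=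
  [/\ forall f, S f -> inL2 D f,
      forall f, S f -> L2inner D f f = 1 &
      forall f g, S f -> S g -> f <> g -> L2inner D f g = 0].

Definition L2total D (S : set (R -> R[i])) : Prop :=
  forall f, inL2 D f -> forall eps : R, 0 < eps ->
  exists (m : nat) (g : 'I_m -> R -> R[i]) (c : 'I_m -> R[i]),
    (forall k, S (g k)) /\
    (L2norm D (fun x => f x - \sum_(k < m) c k * g k x)%R < eps%:E)%E.

Definition L2orthonormal_basis D (S : set (R -> R[i])) : Prop :=
  L2orthonormal D S /\ L2total D S.

Definition echar (lambda : R) : R -> R[i] :=
  fun x => cexp (two_pi_i * (lambda * x)%:C).

Definition normalized_echar D (lambda : R) : R -> R[i] :=
  fun x => ((Num.sqrt (fine (@lebesgue_measure R D)))^-1)%:C * echar lambda x.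

Definition spectral_set D : Prop :=
  exists Lambda : set R,
    L2orthonormal_basis D [set normalized_echar D lambda | lambda in Lambda].

End ComplexL2.

Section SpectralMatrix.
Variables (R : realType) (n : nat).
Implicit Types (alpha beta lambda : 'cV[R]_n) (v : 'cV[R[i]]_n).

Definition Emx v : 'M[R[i]]_n := diag_mx (map_mx (@cexp R) v)^T.

Definition cvC (a : 'cV[R]_n) : 'cV[R[i]]_n := map_mx (fun x : R => x%:C) a.

Definition ker_cV (A : 'M[R[i]]_n) : set 'cV[R[i]]_n := [set v | A *m v = 0].

Definition spectral_mx alpha beta (B : 'M[R[i]]_n) : Prop :=
  forall mu : R[i],
    let K := ker_cV (1%:M - Emx (- (two_pi_i R * mu) *: cvC beta) *m B
                              *m Emx ((two_pi_i R * mu) *: cvC alpha)) in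
    K = [set 0] \/ K = [set c *: const_mx 1 | c in [set: R[i]]].

Definition Mexp (a lambda : 'cV[R]_n) : 'M[R[i]]_n :=
  \matrix_(i, j) (((Num.sqrt n%:R)^-1)%:C *
                  cexp (two_pi_i R * (a i 0 * lambda j 0)%:C)).

Definition interval_union alpha beta : set R :=
  \bigcup_(i in [set: 'I_n]) `]alpha i 0, beta i 0[%classic.

End SpectralMatrix.

(* Main.v *)
(* Write Du = u' / (2 pi i) on the intervals.  By parts, <Du, v> - <u, Dv> is,
   up to a constant, <u(beta), v(beta)> - <u(alpha), v(alpha)>, so D is symmetric
   under a boundary condition u(beta) = B u(alpha) with B unitary, and being
   spectral for B says that the eigenfunctions of D are exponentials.

   Given a spectrum Lambda, the vectors e_l(alpha) with l in Lambda span C^n: if w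
   were orthogonal to them, the expansion of a function u with u(alpha) = w and
   u(beta) = 0 would make <u', u> imaginary, whereas 2 Re <u', u> = - |w|^2.  As
   e_l(alpha) |-> e_l(beta) preserves inner products, it extends to a unitary B,
   and eigenfunctions of D other than e_l, l in Lambda, are orthogonal to all e_l.

   Given B, let Lambda be the set of the l with B e_l(alpha) = e_l(beta); it is
   uniformly discrete and the e_l are orthogonal.  The resolvent of D is explicit
   (Duhamel), so D - t is bounded below off the eigenspace of t.  Hence, for t0
   not in Lambda, on the orthogonal of the finitely many e_l with |l - t0| <= N, the
   symmetric operator D - t0 is bounded below by N, since an almost extremal
   vector would be an approximate eigenvector for some |t| < N.  For u vanishing
   at the endpoints, the residual of its projection on these e_l is then at most
   |(D - t0) u| / N, and such u are dense in L^2. *)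

Require Import Defs.
From mathcomp Require Import all_boot all_order all_algebra.
From mathcomp Require Import complex ring lra.
From mathcomp Require Import all_classical all_reals all_analysis measurable_realfun.

Set Implicit Arguments.
Unset Strict Implicit.
Unset Printing Implicit Defensive.

Import Order.TTheory GRing.Theory Num.Theory.
Import numFieldNormedType.Exports.

Local Open Scope classical_set_scope.
Local Open Scope ring_scope.

Local Notation Re := (@complex.Re _).
Local Notation Im := (@complex.Im _).
Local Notation "x %:C" := (real_complex _ x) (format "x %:C") : ring_scope.

(** * Complex numbers *)

Section ComplexParts.
Variable R : realType.
Implicit Types z w : R[i].

(** Neither a Hilbert space completion nor the spectral theorem is used. Vectors are [n]-tuples of
    continuous functions on the whole line, one per interval, so that endpoint values and
    antiderivatives make sense without limits at the endpoints and integrals come from the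
    fundamental theorem of calculus; general L^2 functions enter only in the density argument. The
    price is that extremal vectors need not exist: the norm of the inverse of [D - t0] on the
    orthogonal of the chosen exponentials is a supremum that may not be attained, so almost extremal
    vectors must do. The shift [t0] makes [D - t0] surjective, and that argument has to solve
    [(D - t0) w = u] inside the orthogonal space. Both directions rest on one identity:
    [2 pi i (t - s) <e_t, e_s>] is the sum of [e_(t - s)] over the points [beta] minus its sum over
    the points [alpha]. For [t != s], orthogonality of [e_t] and [e_s] therefore says that their
    endpoint vectors have the same inner product at [beta] as at [alpha]. The [n] points of the
    statement are points of [Lambda] whose vectors [e_l(alpha)] form a basis of C^n. *)

Lemma complex_ext z w : Re z = Re w -> Im z = Im w -> z = w.
Proof. by case: z w => [a b] [c d] /= -> ->. Qed.

Lemma cReD z w : Re (z + w) = Re z + Re w. Proof. by case: z w => [? ?] []. Qed.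
Lemma cImD z w : Im (z + w) = Im z + Im w. Proof. by case: z w => [? ?] []. Qed.
Lemma cReN z : Re (- z) = - Re z. Proof. by case: z. Qed.
Lemma cImN z : Im (- z) = - Im z. Proof. by case: z. Qed.
Lemma cReM z w : Re (z * w) = Re z * Re w - Im z * Im w.
Proof. by case: z w => [? ?] []. Qed.
Lemma cImM z w : Im (z * w) = Re z * Im w + Im z * Re w.
Proof. by case: z w => [? ?] []. Qed.
Lemma cReJ z : Re z^* = Re z. Proof. by case: z. Qed.
Lemma cImJ z : Im z^* = - Im z. Proof. by case: z. Qed.
Lemma cReC (x : R) : Re x%:C = x. Proof. by []. Qed.
Lemma cImC (x : R) : Im x%:C = 0. Proof. by []. Qed.

Lemma conjC_real (x : R) : (x%:C)^* = x%:C.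
Proof. by apply: complex_ext; rewrite ?cReJ ?cImJ ?cImC ?oppr0. Qed.

Lemma cReI (x y : R) : Re (Complex x y) = x. Proof. by []. Qed.
Lemma cImI (x y : R) : Im (Complex x y) = y. Proof. by []. Qed.

Lemma cRe_sum I (r : seq I) (F : I -> R[i]) :
  Re (\sum_(i <- r) F i) = \sum_(i <- r) Re (F i).
Proof. by apply: big_morph => // ? ?; rewrite cReD. Qed.
Lemma cIm_sum I (r : seq I) (F : I -> R[i]) :
  Im (\sum_(i <- r) F i) = \sum_(i <- r) Im (F i).
Proof. by apply: big_morph => // ? ?; rewrite cImD. Qed.

Definition cpartsE := (cReD, cImD, cReN, cImN, cReM, cImM, cReJ, cImJ, cReC, cImC, cReI, cImI).

(** Real-valued and polynomial in the two parts, so that no square root enters the integrals and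
    inequalities. *)
Definition sqmod z : R := Re z ^+ 2 + Im z ^+ 2.

Lemma sqmod_ge0 z : 0 <= sqmod z.
Proof. by rewrite addr_ge0 ?sqr_ge0. Qed.

Lemma sqmodE z : z * z^* = (sqmod z)%:C.
Proof. by apply: complex_ext; rewrite !cpartsE /sqmod; ring. Qed.

Lemma sqmod_eq0 z : sqmod z = 0 -> z = 0.
Proof.
move/eqP; rewrite paddr_eq0 ?sqr_ge0// !sqrf_eq0 => /andP[/eqP a /eqP b].
exact: complex_ext.
Qed.

Lemma sqmodM z w : sqmod (z * w) = sqmod z * sqmod w.
Proof. by rewrite /sqmod !cpartsE; ring. Qed.

Lemma sqmodD_le z w : sqmod (z + w) <= 2 * sqmod z + 2 * sqmod w.
Proof.
rewrite /sqmod !cpartsE; have := sqr_ge0 (Re z - Re w); have := sqr_ge0 (Im z - Im w).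
lra.
Qed.

Lemma sqmod_cmodulus z : cmodulus z ^+ 2 = sqmod z.
Proof.
by rewrite /cmodulus normc_def cReC sqr_sqrtr // sqmod_ge0.
Qed.

Lemma cmodulus_ge0 z : 0 <= cmodulus z.
Proof. by rewrite /cmodulus normc_def /= sqrtr_ge0. Qed.

End ComplexParts.

(** * Semidefinite Hermitian forms *)

Section PreHilbert.
Variables (R : realType) (V : lmodType R[i]).

(* The axioms are relative to [S], the continuous functions below: integration
   is not additive beyond them.  The form is only semidefinite, as functions on
   the whole line may differ off the intervals. *)
Record prehilbert (S : set V) (ip : V -> V -> R[i]) : Prop := PreHilbert {
  ph0 : S 0;
  phD : forall u v, S u -> S v -> S (u + v);
  phZ : forall (c : R[i]) u, S u -> S (c *: u);
  ipDl : forall u v w, S u -> S v -> S w -> ip (u + v) w = ip u w + ip v w;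
  ipZl : forall (c : R[i]) u w, S u -> S w -> ip (c *: u) w = c * ip u w;
  ipC : forall u v, S u -> S v -> ip v u = (ip u v)^*;
  ip_ge0 : forall u, S u -> 0 <= Re (ip u u) }.

Variables (S : set V) (ip : V -> V -> R[i]).
Hypothesis H : prehilbert S ip.

Definition sqn u : R := Re (ip u u).

Let SD := phD H.
Let SZ := phZ H.

Lemma phN u : S u -> S (- u).
Proof. by move=> Su; rewrite -scaleN1r; apply: SZ. Qed.
Let SN := phN.

Lemma phB u v : S u -> S v -> S (u - v).
Proof. by move=> Su Sv; apply: SD; last exact: SN. Qed.
Let SB := phB.

Local Hint Extern 0 (S _) =>
  (solve [repeat first [assumption | apply: SB | apply: SD | apply: SN | apply: SZ]]) : core.

Lemma ph_sum I (r : seq I) (F : I -> V) :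
  (forall i, S (F i)) -> S (\sum_(i <- r) F i).
Proof. by move=> SF; elim/big_ind: _ => //; exact: ph0 H. Qed.

Lemma ipDr u v w : S u -> S v -> S w -> ip w (u + v) = ip w u + ip w v.
Proof.
move=> Su Sv Sw; rewrite (ipC H) //.
by rewrite (ipDl H) // rmorphD /= -!(ipC H).
Qed.

Lemma ipZr c u w : S u -> S w -> ip w (c *: u) = c^* * ip w u.
Proof.
move=> Su Sw; rewrite (ipC H) //.
by rewrite (ipZl H) // rmorphM /= -(ipC H).
Qed.

Lemma ipNl u w : S u -> S w -> ip (- u) w = - ip u w.
Proof. by move=> Su Sw; rewrite -scaleN1r (ipZl H) // mulN1r. Qed.

Lemma ipNr u w : S u -> S w -> ip w (- u) = - ip w u.
Proof.
by move=> Su Sw; rewrite -scaleN1r ipZr // rmorphN rmorph1 mulN1r.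
Qed.

Lemma ipBl u v w : S u -> S v -> S w -> ip (u - v) w = ip u w - ip v w.
Proof. by move=> Su Sv Sw; rewrite (ipDl H) ?ipNl //. Qed.

Lemma ipBr u v w : S u -> S v -> S w -> ip w (u - v) = ip w u - ip w v.
Proof. by move=> Su Sv Sw; rewrite ipDr ?ipNr //. Qed.

Lemma ip0l w : S w -> ip 0 w = 0.
Proof. by move=> Sw; rewrite -(scale0r w) (ipZl H) // mul0r. Qed.

Lemma ip_suml I (r : seq I) (F : I -> V) w : (forall i, S (F i)) -> S w ->
  ip (\sum_(i <- r) F i) w = \sum_(i <- r) ip (F i) w.
Proof.
move=> SF Sw; elim: r => [|i r IH]; first by rewrite !big_nil ip0l.
by rewrite !big_cons (ipDl H) ?IH //; apply: ph_sum.
Qed.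

Lemma ip_sumr I (r : seq I) (F : I -> V) w : (forall i, S (F i)) -> S w ->
  ip w (\sum_(i <- r) F i) = \sum_(i <- r) ip w (F i).
Proof.
move=> SF Sw; rewrite (ipC H) //; last exact: ph_sum.
rewrite ip_suml // rmorph_sum; apply: eq_bigr => i _.
by rewrite (ipC H (SF i) Sw).
Qed.

Lemma ip_sqn u : S u -> ip u u = (sqn u)%:C.
Proof.
move=> Su; have := ipC H Su Su; rewrite /sqn; case: (ip u u) => a b [] /= e.
by apply: complex_ext => /=; lra.
Qed.

Lemma sqn_ge0 u : S u -> 0 <= sqn u. Proof. exact: (ip_ge0 H). Qed.

Lemma sqnD u v : S u -> S v -> sqn (u + v) = sqn u + 2 * Re (ip u v) + sqn v.
Proof.
move=> Su Sv; rewrite /sqn (ipDl H) ?ipDr //.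
by rewrite (ipC H Su Sv) !cpartsE; ring.
Qed.

Lemma sqnN u : S u -> sqn (- u) = sqn u.
Proof. by move=> Su; rewrite /sqn ipNl ?ipNr ?opprK //. Qed.

Lemma sqnB u v : S u -> S v -> sqn (u - v) = sqn u - 2 * Re (ip u v) + sqn v.
Proof.
move=> Su Sv; rewrite sqnD ?sqnN ?ipNr // ?cReN; ring.
Qed.

Lemma sqnZ c u : S u -> sqn (c *: u) = sqmod c * sqn u.
Proof.
move=> Su; rewrite /sqn (ipZl H) ?ipZr //.
by rewrite mulrA sqmodE ip_sqn // !cpartsE; ring.
Qed.

Lemma sqnD_le u v : S u -> S v -> sqn (u + v) <= 2 * sqn u + 2 * sqn v.
Proof.
move=> Su Sv; have := sqn_ge0 (SB Su Sv); rewrite sqnB // sqnD //; lra.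
Qed.

Lemma sqnB_le u v : S u -> S v -> sqn (u - v) <= 2 * sqn u + 2 * sqn v.
Proof.
by move=> Su Sv; rewrite -(sqnN Sv); apply: sqnD_le => //.
Qed.

(** Expand [sqn (c *: u + v) >= 0] for [c = s] and [c = - s], then divide by [s]. The free weight
    replaces the square roots of Cauchy-Schwarz; in [basis_span] it tends to 0 while [sqn v] stays
    below [s ^+ 2]. *)
Lemma ip_young s u v : 0 < s -> S u -> S v ->
  `|2 * Re (ip u v)| <= s * sqn u + s^-1 * sqn v.
Proof.
move=> s0 Su Sv; have s1 : s * s^-1 = 1 by rewrite divff ?gt_eqF.
have Sz (c : R) : S (c%:C *: u) by exact: SZ.
have qz (c : R) : sqn (c%:C *: u) = c ^+ 2 * sqn u.
  by rewrite sqnZ // /sqmod /=; ring.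
have e (c : R) : Re (ip (c%:C *: u) v) = c * Re (ip u v).
  by rewrite (ipZl H) // !cpartsE; ring.
have h (c : R) : 0 <= c ^+ 2 * sqn u + 2 * (c * Re (ip u v)) + sqn v.
  by rewrite -qz -e -sqnD // sqn_ge0 //.
have hs (c : R) : 0 <= s^-1 * (c ^+ 2 * sqn u + 2 * (c * Re (ip u v)) + sqn v).
  by rewrite mulr_ge0 // invr_ge0 ltW.
have h1 := hs s; have h2 := hs (- s).
have e1 : s^-1 * (s ^+ 2 * sqn u + 2 * (s * Re (ip u v)) + sqn v)
   = (s * s^-1) * (s * sqn u) + 2 * (s * s^-1) * Re (ip u v) + s^-1 * sqn v.
  by ring.
have e2 : s^-1 * ((- s) ^+ 2 * sqn u + 2 * (- s * Re (ip u v)) + sqn v)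
   = (s * s^-1) * (s * sqn u) - 2 * (s * s^-1) * Re (ip u v) + s^-1 * sqn v.
  by ring.
move: h1 h2; rewrite {}e1 {}e2 s1 => h1 h2; rewrite ler_norml; apply/andP; split; lra.
Qed.

Section Projection.
Variables (I : eqType) (e : I -> V) (m : R).
Hypotheses (m_gt0 : 0 < m) (Se : forall i, S (e i)).

(** The vectors are left unnormalized with common squared norm [m]; for exponentials [m] is the
    length of the set. *)
Definition ph_proj (s : seq I) u : V :=
  \sum_(i <- s) (ip u (e i) / m%:C) *: e i.

Lemma ph_proj_in s u : S (ph_proj s u).
Proof. by apply: ph_sum => i; apply: SZ. Qed.

Hypothesis e_norm : forall i, ip (e i) (e i) = m%:C.
Let mC0 : m%:C != 0 :> R[i].
Proof. by rewrite (inj_eq (@complexI R)) gt_eqF. Qed.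

Variable s : seq I.
Hypotheses (us : uniq s)
  (e_orth : {in s &, forall i j, i != j -> ip (e i) (e j) = 0}).

Lemma ip_proj u i : S u -> i \in s -> ip (ph_proj s u) (e i) = ip u (e i).
Proof.
move=> Su si; rewrite /ph_proj ip_suml //; last by move=> j; apply: SZ.
rewrite (bigD1_seq i) //= (ipZl H) // e_norm divfK // big_seq_cond big1 ?addr0//.
by move=> j /andP[sj ji]; rewrite (ipZl H) // e_orth ?mulr0.
Qed.

Lemma ip_proj_orth u i : S u -> i \in s -> ip (u - ph_proj s u) (e i) = 0.
Proof.
by move=> Su si; rewrite ipBl ?ip_proj ?subrr //; apply: ph_proj_in.
Qed.

(** Pythagoras: the residual is orthogonal to the projection minus the competitor. The indices [l a]
    may repeat, as in the combinations that [L2total] supplies. *)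
Lemma ph_proj_best u (k : nat) (c : 'I_k -> R[i]) (l : 'I_k -> I) : S u ->
  (forall a, l a \in s) ->
  sqn (u - ph_proj s u) <= sqn (u - \sum_a c a *: e (l a)).
Proof.
move=> Su ls; set p := \sum_a _.
have Sp : S p by apply: ph_sum => a; apply: SZ.
have SP := ph_proj_in s u.
rewrite -[u - p](subrKA (ph_proj s u)) [leRHS]sqnD //.
suff -> : ip (u - ph_proj s u) (ph_proj s u - p) = 0.
  by rewrite mulr0 addr0 lerDl sqn_ge0 //.
rewrite ipBr ?[u - _]/u //.
rewrite /p {2}/ph_proj !ip_sumr; try (by move=> ?; apply: SZ); try exact: SB.
rewrite big_seq big1 ?big1 ?subr0 // => [a _|a sa].
  by rewrite ipZr ?ip_proj_orth ?mulr0 //.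
by rewrite ipZr ?ip_proj_orth ?mulr0 //.
Qed.

Lemma ph_proj_bessel u : S u -> sqn (u - ph_proj s u) <= sqn u.
Proof.
move=> Su; have l : 'I_0 -> I by case.
by have := @ph_proj_best u 0 (fun=> 0) l Su; rewrite big_ord0 subr0; apply => -[].
Qed.

End Projection.

(* [G u g] reads [A u = g] for a symmetric operator [A].  If [A - z] is bounded
   below on the invariant subspace [K] for every real [|z| < N], then [A] is
   bounded below by [N] on [K]. *)
Section LowerBound.
Variables (G : V -> V -> Prop) (K : set V) (N : R).
Hypotheses (N_gt0 : 0 < N)
  (GS : forall u g, G u g -> S u /\ S g)
  (G_lin : forall (c : R[i]) u g v h, G u g -> G v h ->
     G (c *: u + v) (c *: g + h))
  (G_sym : forall u g v h, G u g -> G v h -> ip g v = ip u h)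
  (K_lin : forall (c : R[i]) u v, K u -> K v -> K (c *: u + v))
  (G_solve : forall g, S g -> K g -> exists2 u, G u g & K u)
  (G_below : forall z : R, `|z| < N -> exists2 C : R, 0 <= C &
     forall u g, G u g -> K u -> sqn u <= C * sqn (g - z%:C *: u)).

(* With [M = sup |u| / |A u|] and [A w = u], [A u] almost extremal,
   [(1 - M A) (1 + M A) w = w - M ^+ 2 A ^+ 2 w] is small by symmetry of [A];
   both factors being bounded below if [M^-1 < N], so is [w], a contradiction. *)
Lemma symmetric_lower_bound u g : G u g -> K u -> N ^+ 2 * sqn u <= sqn g.
Proof.
move=> Gu0 Ku0; rewrite leNgt; apply/negP => lt0.
have [C0 C0_ge0 hC0] : exists2 C : R, 0 <= C & forall u g, G u g -> K u -> sqn u <= C * sqn g.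
  have [|C C0 hC] := @G_below 0; first by rewrite normr0.
  by exists C => // u' g' Gu Ku; have := hC _ _ Gu Ku; rewrite scale0r subr0.
pose E : set R := [set x | exists u g, [/\ G u g, K u, 0 < sqn g & x = sqn u / sqn g]].
have N2 : 0 < N ^+ 2 by rewrite exprn_gt0.
have qg0 : 0 < sqn g.
  have [Su Sg] := GS Gu0; rewrite lt_neqAle sqn_ge0 // andbT eq_sym.
  apply/eqP => e0; have := hC0 _ _ Gu0 Ku0; rewrite e0 mulr0 => h.
  have : N ^+ 2 * sqn u <= 0 by rewrite mulr_ge0_le0 // ltW.
  by move: lt0; rewrite e0; lra.
have supE : has_sup E.
  split; first by exists (sqn u / sqn g); exists u, g.
  exists C0 => _ [v [h [Gv Kv h0 ->]]].
  by rewrite ler_pdivrMr // hC0.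
set M2 := sup E.
have M2_lb : (N ^+ 2)^-1 < M2.
  apply: (@lt_le_trans _ _ (sqn u / sqn g)).
    by rewrite ltr_pdivlMr // mulrC ltr_pdivrMr // mulrC.
  by apply: sup_upper_bound => //; exists u, g.
have M2_gt0 : 0 < M2 by rewrite (lt_trans _ M2_lb) // invr_gt0.
have hM v h : G v h -> K v -> sqn v <= M2 * sqn h.
  move=> Gv Kv; have [Sv Sh] := GS Gv.
  have [h0|h0] := ltP 0 (sqn h).
    by rewrite -ler_pdivrMr //; apply: sup_upper_bound => //; exists v, h.
  have {}h0 : sqn h = 0 by apply/le_anti; rewrite h0 sqn_ge0.
  by have := hC0 _ _ Gv Kv; rewrite h0 !mulr0.
pose z := (Num.sqrt M2)^-1.
have z2 : z ^+ 2 = M2^-1 by rewrite exprVn sqr_sqrtr // ltW.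
have z0 : 0 < z by rewrite invr_gt0 sqrtr_gt0.
have zN : `|z| < N.
  rewrite gtr0_norm // -(ltr_pXn2r (n := 2)) ?nnegrE ?ltW // z2.
  by rewrite -[ltRHS]invrK ltf_pV2 ?posrE ?invr_gt0.
have [C1 C1_ge0 hC1] := G_below zN.
have [|C2 C2_ge0 hC2] := @G_below (- z); first by rewrite normrN.
pose c := (2 * C1 * C2 / M2 ^+ 2 + 2) * M2.
have c0 : 0 < c.
  have : 0 <= 2 * C1 * C2 / M2 ^+ 2 by rewrite divr_ge0 ?sqr_ge0 ?mulr_ge0.
  by move=> ?; rewrite mulr_gt0 //; lra.
have key eps : 0 < eps -> M2 ^+ 2 <= c * eps.
  move=> eps0; have [x [v [h [Gv Kv h0 ->]]] ltx] := sup_adherent eps0 supE.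
  rewrite -/M2 ltr_pdivlMr // in ltx.
  have [Sv Sh] := GS Gv; have [w Gw Kw] := G_solve Sv Kv; have [Sw _] := GS Gw.
  pose X := w - M2%:C *: h.
  have SX : S X by apply: SB => //.
  (* By symmetry [ip w h = ip v v], so [sqn X = sqn w - 2 * M2 * sqn v + M2 ^+ 2 * sqn h]. Now
     [sqn w <= M2 * sqn v], and almost extremality gives [(M2 - eps) * sqn h < sqn v]. *)
  have qX : sqn X <= M2 * eps * sqn h.
    rewrite /X sqnB //.
    rewrite ipZr // -(G_sym Gw Gv) sqnZ // ip_sqn // !cpartsE.
    rewrite /sqmod /=.
    have := hM _ _ Gw Kw; move: ltx M2_gt0; move: (sqn w) (sqn h) (sqn v) => W h' v' .
    nra.
  (* With [y = z w + v = (A + z) w], one gets [(A - z) y = h - z ^+ 2 w = - z ^+ 2 X]. The two lower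
     bounds make [w] small, and then also [M2 h = w - X]. *)
  have Gy : G (z%:C *: w + v) (z%:C *: v + h) by exact: G_lin.
  have Ky : K (z%:C *: w + v) by exact: K_lin.
  have b1 := hC1 _ _ Gy Ky; have b2 := hC2 _ _ Gw Kw.
  have e1 : z%:C *: v + h - z%:C *: (z%:C *: w + v) = (- z ^+ 2)%:C *: X.
    rewrite scalerDr scalerA opprD [- _ - _]addrC addrACA subrr add0r.
    rewrite /X scalerBr scalerA -!rmorphM /= z2 mulNr mulVf ?gt_eqF //.
    by rewrite !rmorphN rmorph1 /= !scaleNr opprK scale1r addrC -expr2 z2.
  have e2 : v - (- z)%:C *: w = z%:C *: w + v.
    by rewrite rmorphN /= scaleNr opprK addrC.
  rewrite e1 sqnZ // in b1; rewrite e2 in b2.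
  have z4 : sqmod (- z ^+ 2)%:C = (M2 ^+ 2)^-1.
    by rewrite /sqmod /= z2 sqrrN expr0n addr0 exprVn.
  rewrite z4 in b1.
  have b3 : sqn w <= C2 * (C1 * ((M2 ^+ 2)^-1 * sqn X)).
    by apply: (le_trans b2); rewrite ler_wpM2l.
  have b4 : M2 ^+ 2 * sqn h <= 2 * sqn w + 2 * sqn X.
    apply: le_trans (sqnB_le Sw SX); rewrite /X subKr sqnZ //.
    by rewrite /sqmod /= expr0n addr0.
  have M22 : 0 < M2 ^+ 2 by rewrite exprn_gt0.
  rewrite -(ler_pM2r h0); apply: (le_trans b4).
  have -> : c * eps * sqn h = 2 * (C2 * (C1 * ((M2 ^+ 2)^-1 * (M2 * eps * sqn h))))
      + 2 * (M2 * eps * sqn h) by rewrite /c; ring.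
  rewrite lerD // ler_wpM2l //; apply: (le_trans b3).
  by rewrite !ler_wpM2l // invr_ge0 ltW.
have := key (M2 ^+ 2 / c / 2); have p : 0 < M2 ^+ 2 by rewrite exprn_gt0.
rewrite !divr_gt0 // => /(_ isT).
rewrite (_ : c * _ = M2 ^+ 2 / 2); last by field; rewrite gt_eqF.
by move=> h; lra.
Qed.

End LowerBound.
End PreHilbert.

(** * Calculus on an interval *)

Section RealCalculus.
Variable R : realType.
Implicit Types (f g F : R -> R) (a b : R).
Local Notation mu := (@lebesgue_measure R).

Lemma is_derive_continuous F f : (forall x : R, is_derive x 1 F (f x)) -> continuous F.
Proof.
move=> dF x; have dx := dF x.
by apply: differentiable_continuous; apply/derivable1_diffP.
Qed.

Lemma continuous_integrable_itv f a b : continuous f ->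
  mu.-integrable `[a, b] (EFin \o f).
Proof.
move=> cf; apply: continuous_compact_integrable; first exact: segment_compact.
by apply: continuous_subspaceT.
Qed.

Lemma Rintegral_FTC F f a b : a < b -> continuous f ->
  (forall x : R, is_derive x 1 F (f x)) ->
  \int[mu]_(x in `[a, b]) f x = F b - F a.
Proof.
move=> ab cf dF; have cF := is_derive_continuous dF.
rewrite /Rintegral (@continuous_FTC2 _ f F) //.
- exact: continuous_subspaceT.
- split; first by move=> x _; have [] := dF x.
  + by apply: cvg_at_right_filter; apply: cF.
  + by apply: cvg_at_left_filter; apply: cF.
- by move=> x _; rewrite derive1E; have [] := dF x.
Qed.

Lemma is_derive_add F G (x u v : R) : is_derive x 1 F u -> is_derive x 1 G v ->
  is_derive x 1 (fun y => F y + G y) (u + v).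
Proof. by move=> dF dG; apply: is_deriveD. Qed.

Lemma is_derive_opp F (x u : R) : is_derive x 1 F u ->
  is_derive x 1 (fun y => - F y) (- u).
Proof. by move=> dF; apply: is_deriveN. Qed.

Lemma is_derive_sub F G (x u v : R) : is_derive x 1 F u -> is_derive x 1 G v ->
  is_derive x 1 (fun y => F y - G y) (u - v).
Proof. by move=> dF dG; apply: is_deriveB. Qed.

Lemma is_derive_mul F G (x u v : R) : is_derive x 1 F u -> is_derive x 1 G v ->
  is_derive x 1 (fun y => F y * G y) (u * G x + F x * v).
Proof.
move=> dF dG; apply: is_derive_eq.
by rewrite /GRing.scale /=; ring.
Qed.

Lemma is_derive_scale (k : R) F (x u : R) : is_derive x 1 F u ->
  is_derive x 1 (fun y => k * F y) (k * u).
Proof. by move=> dF; apply: is_deriveZ. Qed.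

Lemma is_derive_const (k x : R) : is_derive x 1 (fun=> k) (0 : R).
Proof. exact: is_derive_cst. Qed.

Lemma is_derive_ident (x : R) : is_derive x 1 (fun y : R => y) (1 : R).
Proof. exact: is_derive_id. Qed.

(** An integral from a fixed base point is an antiderivative only to the right of that point. The
    base point [- (|y| + 1)] therefore moves with [y], and subtracting the value at 0 makes the
    result independent of it. *)
Lemma antiderivative f : continuous f ->
  exists F, forall x : R, is_derive x 1 F (f x).
Proof.
move=> cf; pose P k y := \int[mu]_(t in `[- k, y]) f t.
have iP a b := continuous_integrable_itv a b cf.
have PS k k' y : k <= k' -> - k <= y -> P k' y - P k' (- k) = P k y.
  move=> kk ky; rewrite /P Rintegral_itvB //.
  - by apply: Rintegral_itv_obnd_cbnd; apply: integrableS (iP (- k) y) => //;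
      move=> z; rewrite /= !in_itv /= => /andP[/ltW -> ->].
  - by rewrite bnd_simp lerN2.
have PD k k' y z : k <= k' -> - k <= y -> - k <= z ->
    P k' y - P k' z = P k y - P k z.
  by move=> kk ky kz; rewrite -(PS k k' y) // -(PS k k' z) //; ring.
exists (fun y => P (`|y| + 1) y - P (`|y| + 1) 0) => x.
pose k := `|x| + 2.
apply: (@near_eq_is_derive _ _ _ (fun y => P k y - P k 0)).
  near=> y.
    have : ball x 1 y by near: y; exact: nbhsx_ballx.
    rewrite /ball /= ltr_norml => /andP[yx1 yx2].
    have hx : `|x| <= k - 2 by rewrite /k addrK.
    have hy : `|y| <= k - 1.
      by move: hx; rewrite !ler_norml => /andP[? ?]; apply/andP; split; lra.
    have := normr_ge0 y; have := ler_norml y `|y|; rewrite lexx => /esym/andP[h1 h2] h3.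
    by apply: PD; lra.
have xx : x < x + 1 by rewrite ltrDl.
have [|d1 d2] := @continuous_FTC1 _ f (BLeft (- k)) x (x + 1) xx (iP _ _) _ (cf x).
  rewrite lte_fin; have := ler_norml x `|x|; rewrite lexx => /esym/andP[h1 _]; rewrite /k; lra.
rewrite -d2 derive1E -[X in is_derive _ _ _ X]subr0.
exact: is_derive_sub (derivableP d1) (is_derive_const _ _).
Unshelve. all: by end_near. Qed.

Lemma is_derive_ge0_le F f a b : (forall x : R, is_derive x 1 F (f x)) ->
  (forall x, a <= x <= b -> 0 <= f x) -> a <= b -> F a <= F b.
Proof.
move=> dF f0 ab.
have [|c] := @MVT_segment R F f a b ab.
  by apply: continuous_subspaceT; apply: is_derive_continuous dF.
rewrite in_itv /= => cab e; rewrite -subr_ge0 e mulr_ge0 ?subr_ge0 //.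
exact: f0.
Qed.

(* Cauchy-Schwarz for the pair [(f, 1)]: [P - 2 c F + c ^+ 2 x] is nondecreasing for all [c]. *)
Lemma antiderivative_cauchy_schwarz F P f a x :
  (forall x : R, is_derive x 1 F (f x)) ->
  (forall x : R, is_derive x 1 P (f x ^+ 2)) -> a <= x ->
  (F x - F a) ^+ 2 <= (x - a) * (P x - P a).
Proof.
move=> dF dP; rewrite le_eqVlt => /predU1P[->|ax]; first by rewrite !subrr mul0r expr0n.
have key (c : R) : 0 <= (P x - P a) - 2 * c * (F x - F a) + c ^+ 2 * (x - a).
  have d (y : R) : is_derive y 1 (fun y => P y - (2 * c) * F y + c ^+ 2 * y) ((f y - c) ^+ 2).
    by apply: is_derive_eq; rewrite /GRing.scale /=; ring.
  have h := is_derive_ge0_le d (fun _ _ => sqr_ge0 _) (ltW ax).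
  lra.
have xa : 0 < x - a by rewrite subr_gt0.
have := key ((F x - F a) / (x - a)).
set A := P x - P a; set B := F x - F a; set C := x - a in xa *.
have -> : A - 2 * (B / C) * B + (B / C) ^+ 2 * C = A - B ^+ 2 / C.
  by field; rewrite gt_eqF.
by rewrite subr_ge0 ler_pdivrMr // mulrC.
Qed.

End RealCalculus.

(** * Complex-valued functions of a real variable *)

Section ComplexCalculus.
Variable R : realType.
Implicit Types (f g : R -> R[i]) (a b : R).
Local Notation mu := (@lebesgue_measure R).

Definition ccont f : Prop :=
  continuous (fun x => Re (f x)) /\ continuous (fun x => Im (f x)).

Definition cderiv f df : Prop := forall x : R,
  is_derive x 1 (fun x => Re (f x)) (Re (df x)) /\
  is_derive x 1 (fun x => Im (f x)) (Im (df x)).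

Lemma ccont_cst (c : R[i]) : ccont (fun=> c).
Proof. by split=> x; apply: cvg_cst. Qed.

Lemma ccontD f g : ccont f -> ccont g -> ccont (fun x => f x + g x).
Proof.
move=> [f1 f2] [g1 g2]; split=> x.
  by under eq_fun do rewrite cReD; apply: cvgD; [apply: f1|apply: g1].
by under eq_fun do rewrite cImD; apply: cvgD; [apply: f2|apply: g2].
Qed.

Lemma ccontM f g : ccont f -> ccont g -> ccont (fun x => f x * g x).
Proof.
move=> [f1 f2] [g1 g2]; split=> x.
  under eq_fun do rewrite cReM.
  by apply: cvgB; apply: cvgM; [apply: f1|apply: g1|apply: f2|apply: g2].
under eq_fun do rewrite cImM.
by apply: cvgD; apply: cvgM; [apply: f1|apply: g2|apply: f2|apply: g1].
Qed.

Lemma ccontJ f : ccont f -> ccont (fun x => (f x)^*).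
Proof.
move=> [f1 f2]; split=> x; first by under eq_fun do rewrite cReJ; apply: f1.
by under eq_fun do rewrite cImJ; apply: cvgN; apply: f2.
Qed.

Lemma cderiv_eq f df df' : df =1 df' -> cderiv f df -> cderiv f df'.
Proof. by move=> /funext ->. Qed.

Lemma cderiv_ccont f df : cderiv f df -> ccont f.
Proof.
move=> d; split; apply: (@is_derive_continuous _ _ (fun x => _)) => x; first exact: (d x).1.
exact: (d x).2.
Qed.

Lemma cderiv_cst (c : R[i]) : cderiv (fun=> c) (fun=> 0).
Proof. by move=> x; split; apply: is_derive_cst. Qed.

Lemma cderivD f df g dg : cderiv f df -> cderiv g dg ->
  cderiv (fun x => f x + g x) (fun x => df x + dg x).
Proof.
move=> hf hg x; have [f1 f2] := hf x; have [g1 g2] := hg x.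
split; first by under eq_fun do rewrite cReD; rewrite cReD; apply: is_derive_add.
by under eq_fun do rewrite cImD; rewrite cImD; apply: is_derive_add.
Qed.

Lemma cderivJ f df : cderiv f df -> cderiv (fun x => (f x)^*) (fun x => (df x)^*).
Proof.
move=> hf x; have [f1 f2] := hf x.
split; first by under eq_fun do rewrite cReJ; rewrite cReJ.
by under eq_fun do rewrite cImJ; rewrite cImJ; apply: is_derive_opp.
Qed.

Lemma cderivM f df g dg : cderiv f df -> cderiv g dg ->
  cderiv (fun x => f x * g x) (fun x => df x * g x + f x * dg x).
Proof.
move=> hf hg x; have [f1 f2] := hf x; have [g1 g2] := hg x.
split.
  under eq_fun do rewrite cReM.
  by apply: is_derive_eq; rewrite !cpartsE /GRing.scale /=; ring.
under eq_fun do rewrite cImM.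
by apply: is_derive_eq; rewrite !cpartsE /GRing.scale /=; ring.
Qed.

Lemma cderivZ (c : R[i]) f df : cderiv f df ->
  cderiv (fun x => c * f x) (fun x => c * df x).
Proof.
move=> hf; have := cderivM (cderiv_cst c) hf.
by apply: cderiv_eq => x; rewrite mul0r add0r.
Qed.

Lemma cderiv_cexp (c : R[i]) :
  cderiv (fun x => cexp (c * x%:C)) (fun x => c * cexp (c * x%:C)).
Proof.
move=> x; case: c => p q.
have dl (k : R) : is_derive x 1 (fun y => k * y) k.
  by apply: is_derive_eq; rewrite /GRing.scale /= mulr1.
have dE : is_derive x 1 (fun y => expR (p * y)) (expR (p * x) * p).
  exact: (@is_derive1_comp _ expR (fun y => p * y)).
have dC : is_derive x 1 (fun y => cos (q * y)) (- sin (q * x) * q).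
  exact: (@is_derive1_comp _ cos (fun y => q * y)).
have dS : is_derive x 1 (fun y => sin (q * y)) (cos (q * x) * q).
  exact: (@is_derive1_comp _ sin (fun y => q * y)).
have e y : cexp (Complex p q * y%:C) =
    Complex (expR (p * y) * cos (q * y)) (expR (p * y) * sin (q * y)).
  by apply: complex_ext; rewrite /cexp /=;
    rewrite !mulr0 !mul0r ?subr0 ?add0r ?addr0.
have h1 := is_derive_mul dE dC; have h2 := is_derive_mul dE dS.
split; under eq_fun do rewrite e /=.
  apply: (@is_derive_eq _ _ _ _ _ _ _ _ h1); rewrite e !cpartsE.
  have r (E C S : R) : E * p * C + E * (- S * q) = p * (E * C) - q * (E * S) by ring.
  exact: r.
apply: (@is_derive_eq _ _ _ _ _ _ _ _ h2); rewrite e !cpartsE.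
have r (E C S : R) : E * p * S + E * (C * q) = p * (E * S) + q * (E * C) by ring.
exact: r.
Qed.

Lemma cantiderivative f : ccont f -> exists F, cderiv F f.
Proof.
move=> [/antiderivative[F hF] /antiderivative[G hG]].
by exists (fun x => Complex (F x) (G x)) => x; split; [apply: hF | apply: hG].
Qed.

(** Closed intervals suit the fundamental theorem; [integral_glue] passes to the open intervals of
    the union. *)
Definition cint a b f : R[i] := cintegral `[a, b]%classic f.

Lemma cint_FTC F f a b : a < b -> ccont f -> cderiv F f ->
  cint a b f = F b - F a.
Proof.
move=> ab [c1 c2] d; apply: complex_ext; rewrite ?cpartsE /=.
  by apply: (Rintegral_FTC (F := fun x => Re (F x))) => // x; apply: (d x).1.
by apply: (Rintegral_FTC (F := fun x => Im (F x))) => // x; apply: (d x).2.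
Qed.

(** Going through antiderivatives turns the integrability conditions into continuity. *)
Lemma cintD f g a b : a < b -> ccont f -> ccont g ->
  cint a b (fun x => f x + g x) = cint a b f + cint a b g.
Proof.
move=> ab cf cg; have [F dF] := cantiderivative cf; have [G dG] := cantiderivative cg.
rewrite (cint_FTC ab cf dF) (cint_FTC ab cg dG).
by rewrite (cint_FTC ab (ccontD cf cg) (cderivD dF dG)); ring.
Qed.

Lemma cintZ (c : R[i]) f a b : a < b -> ccont f ->
  cint a b (fun x => c * f x) = c * cint a b f.
Proof.
move=> ab cf; have [F dF] := cantiderivative cf; rewrite (cint_FTC ab cf dF).
by rewrite (cint_FTC ab (ccontM (ccont_cst c) cf) (cderivZ c dF)); ring.
Qed.

Lemma cintJ f a b : a < b -> ccont f ->
  cint a b (fun x => (f x)^*) = (cint a b f)^*.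
Proof.
move=> ab cf; have [F dF] := cantiderivative cf; rewrite (cint_FTC ab cf dF).
by rewrite (cint_FTC ab (ccontJ cf) (cderivJ dF)) rmorphB.
Qed.

Lemma ccont_sqmod f : ccont f -> continuous (fun x => sqmod (f x)).
Proof.
move=> cf; have [+ _] := ccontM cf (ccontJ cf).
by under eq_fun do rewrite sqmodE cReC.
Qed.

Lemma Re_cint_sqmod f a b :
  Re (cint a b (fun x => f x * (f x)^*)) = \int[mu]_(x in `[a, b]) sqmod (f x).
Proof. by rewrite /cint /cintegral /=; under eq_Rintegral do rewrite sqmodE cReC. Qed.

Lemma Re_cint_sqmod_le f a b (M : R) : a < b -> ccont f ->
  (forall x, a <= x <= b -> sqmod (f x) <= M) ->
  Re (cint a b (fun x => f x * (f x)^*)) <= (b - a) * M.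
Proof.
move=> ab cf fM; have cs := ccont_sqmod cf.
rewrite Re_cint_sqmod; have [P dP] := antiderivative cs.
rewrite (Rintegral_FTC ab cs dP).
have d (y : R) : is_derive y 1 (fun y => M * y - P y) (M - sqmod (f y)).
  by apply: is_derive_eq; rewrite /GRing.scale /= mulr1.
have h0 x : a <= x <= b -> 0 <= M - sqmod (f x) by move=> xab; rewrite subr_ge0 fM.
have h := is_derive_ge0_le d h0 (ltW ab).
lra.
Qed.

(** An antiderivative of [sqmod (f x)] is nondecreasing with equal values at [a] and [b], hence
    constant in between. *)
Lemma cint_sqmod_eq0 f a b x : a < b -> ccont f ->
  Re (cint a b (fun x => f x * (f x)^*)) = 0 -> a < x < b -> f x = 0.
Proof.
move=> ab cf; have cs := ccont_sqmod cf.
rewrite Re_cint_sqmod; have [P dP] := antiderivative cs.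
rewrite (Rintegral_FTC ab cs dP) => Pab /andP[ax xb]; apply: sqmod_eq0.
have h0 a' b' x' : a' <= x' <= b' -> 0 <= sqmod (f x') by rewrite sqmod_ge0.
have Pc y : a <= y <= b -> P y = P a.
  move=> /andP[ay yb]; have := is_derive_ge0_le dP (@h0 a y) ay.
  by have := is_derive_ge0_le dP (@h0 y b) yb; lra.
have : is_derive x 1 P 0.
  apply: (@near_eq_is_derive _ _ _ (cst (P a))).
  near=> y; rewrite Pc //; apply/andP; split; near: y.
    by apply: (cvgr_ge x) => //; exact: cvg_id.
  by apply: (cvgr_le x) => //; exact: cvg_id.
by move=> /@derive_val <-; rewrite -(@derive_val _ _ _ _ _ _ _ (dP x)).
Unshelve. all: by end_near. Qed.

(** Cauchy-Schwarz for each of the two parts. This control of a primitive at every point by an L^2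
    norm is what bounds the resolvent in [dop_estimate]. *)
Lemma antiderivative_bound F f a b x : cderiv F f -> ccont f -> a <= x <= b -> a < b ->
  sqmod (F x - F a) <= (b - a) * Re (cint a b (fun x => f x * (f x)^*)).
Proof.
move=> dF cf /andP[ax xb] ab.
have cq (g : R -> R) : continuous g -> continuous (fun x => g x ^+ 2).
  by move=> cg y; under eq_fun do rewrite expr2; apply: cvgM; apply: cg.
have [P1 dP1] := antiderivative (cq _ cf.1).
have [P2 dP2] := antiderivative (cq _ cf.2).
have cs := ccont_sqmod cf.
have dP (y : R) : is_derive y 1 (fun y => P1 y + P2 y) (sqmod (f y)).
  by apply: is_derive_add.
rewrite Re_cint_sqmod (Rintegral_FTC ab cs dP).
have h1 := antiderivative_cauchy_schwarz (fun y => (dF y).1) dP1 ax.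
have h2 := antiderivative_cauchy_schwarz (fun y => (dF y).2) dP2 ax.
have h3 := is_derive_ge0_le dP (fun y _ => sqmod_ge0 _) xb.
have h4 := is_derive_ge0_le dP (fun y _ => sqmod_ge0 _) ax.
rewrite /sqmod !cpartsE; nra.
Qed.

End ComplexCalculus.

(** * Functions on a union of intervals *)

Section IntervalUnion.
Variables (R : realType) (n : nat) (alpha beta : 'cV[R]_n).
Hypothesis alpha_lt_beta : forall i : 'I_n, alpha i 0 < beta i 0.
Hypothesis beta_lt_alpha : forall i j : 'I_n, j = i.+1 :> nat ->
  beta i 0 < alpha j 0.
Local Notation mu := (@lebesgue_measure R).
Local Notation Omega := (interval_union alpha beta).
Local Notation I_ j := `]alpha j 0, beta j 0[%classic.

Lemma beta_le_alpha (i j : 'I_n) : (i < j)%N -> beta i 0 < alpha j 0.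
Proof.
move: j => [j jn]; elim: j jn => // j IH jn /=.
rewrite ltnS leq_eqVlt => /predU1P[e|ij]; first by apply: beta_lt_alpha; rewrite /= e.
have jn' : (j < n)%N by exact: ltnW.
apply: (lt_trans (IH jn' ij)); apply: (lt_trans (alpha_lt_beta _)).
exact: beta_lt_alpha.
Qed.

Lemma trivIset_interval_union (D : set 'I_n) : trivIset D (fun j => I_ j).
Proof.
apply/trivIsetP => i j _ _ ij; rewrite -subset0 => x /=; rewrite !in_itv /=.
move=> [/andP[h1 h2] /andP[h3 h4]].
case: (ltngtP i j) ij => [ij _|ji _|/val_inj ->].
- by have := beta_le_alpha ij; lra.
- by have := beta_le_alpha ji; lra.
- by rewrite eqxx.
Qed.

Lemma interval_unionE : Omega = \big[setU/set0]_(j <- enum 'I_n) I_ j.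
Proof.
rewrite -bigcup_seq; congr bigcup; apply/seteqP; split => j //= _.
by rewrite mem_enum.
Qed.

Lemma measurable_interval_union : measurable Omega.
Proof. by apply: fin_bigcup_measurable => // i _; exact: measurable_itv. Qed.

Lemma measurable_fun_interval_union (f : R -> R) :
  (forall j, measurable_fun (I_ j) f) -> measurable_fun Omega f.
Proof.
move=> mf _ Y mY; rewrite setI_bigcupl; apply: fin_bigcup_measurable => // j _.
by apply: mf => //; exact: measurable_itv.
Qed.

Section Glue.
Variables (h : R -> R) (k : 'I_n -> R -> R).
Hypothesis ck : forall j, continuous (k j).
Hypothesis hk : forall j x, alpha j 0 < x < beta j 0 -> h x = k j x.

Lemma measurable_fun_glue : measurable_fun Omega h.
Proof.
apply: measurable_fun_interval_union => j.
apply: (@eq_measurable_fun _ _ _ _ _ (k j)).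
  by move=> x; rewrite inE /= in_itv /= => /hk.
apply: measurable_funTS; exact: continuous_measurable_fun.
Qed.

(** Each [k j] is continuous on the whole line, whereas [h] matches it only inside the open
    interval; the endpoints are negligible. *)
Lemma integral_glue : (\int[mu]_(x in Omega) (h x)%:E)%E =
  (\sum_(j < n) \int[mu]_(x in `[alpha j 0, beta j 0]) k j x)%:E.
Proof.
have /measurable_EFinP mh := measurable_fun_glue.
rewrite interval_unionE integral_bigsetU_EFin.
- rewrite big_enum -sumEFin; apply: eq_bigr => j _.
  have -> : (\int[mu]_(x in I_ j) (h x)%:E = \int[mu]_(x in I_ j) (k j x)%:E)%E.
    by apply: eq_integral => x; rewrite inE /= in_itv /= => /hk ->.
  rewrite /Rintegral -(@integral_itv_bndoo _ _ _ _ true false); last first.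
    by apply: measurable_funTS; apply/measurable_EFinP; exact: continuous_measurable_fun.
  rewrite fineK //; apply: integrable_fin_num; first exact: measurable_itv.
  exact: continuous_integrable_itv.
- by move=> j; exact: measurable_itv.
- exact: enum_uniq.
- exact: trivIset_interval_union.
- by rewrite -interval_unionE.
Qed.

End Glue.

Lemma lebesgue_interval_union : mu Omega = (\sum_(j < n) (beta j 0 - alpha j 0))%:E.
Proof.
have c1 : continuous (cst 1 : R -> R) by exact: cst_continuous.
have := @integral_glue (cst 1) (fun=> cst 1) (fun=> c1) (fun _ _ _ => erefl).
have -> : (\int[mu]_(x in Omega) (cst 1 x)%:E = mu Omega)%E.
  by apply: (etrans (integral_cst mu measurable_interval_union 1%:E)); rewrite mul1e.
move=> ->; congr (_%:E); apply: eq_bigr => j _.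
by rewrite (@Rintegral_FTC _ idfun (cst 1)).
Qed.

Lemma measure_interval_union_gt0 : (0 < n)%N -> 0 < fine (mu Omega).
Proof.
move=> n0; rewrite lebesgue_interval_union /=; pose j0 := Ordinal n0.
rewrite (bigD1 j0) //= ltr_wpDr ?subr_gt0 //.
by apply: sumr_ge0 => j _; rewrite subr_ge0 ltW.
Qed.

Local Notation V := ('I_n -> R -> (R[i])^o).

(** Neighbouring intervals carry unrelated functions, each extended to the whole line, so that
    endpoint values are plain evaluations. *)
Definition tcont : set V := [set u | forall j, ccont (u j)].

Definition tip (u v : V) : R[i] :=
  \sum_(j < n) cint (alpha j 0) (beta j 0) (fun x => u j x * (v j x)^*).

Definition tderiv (u du : V) : Prop := forall j, cderiv (u j) (du j).

Definition bdry (u v : V) : R[i] :=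
  \sum_(j < n) (u j (beta j 0) * (v j (beta j 0))^* -
                u j (alpha j 0) * (v j (alpha j 0))^*).

Lemma sqn_sum (u : V) : sqn tip u = \sum_j Re (cint (alpha j 0) (beta j 0)
  (fun x => u j x * (u j x)^*)).
Proof. by rewrite /sqn cRe_sum. Qed.

Lemma Re_cint_ge0 (u : V) j : 0 <= Re (cint (alpha j 0) (beta j 0)
  (fun x => u j x * (u j x)^*)).
Proof. by rewrite Re_cint_sqmod; apply: Rintegral_ge0 => x _; exact: sqmod_ge0. Qed.

Lemma tip_prehilbert : prehilbert tcont tip.
Proof.
have cJ (u v : V) j : tcont u -> tcont v -> ccont (fun x => u j x * (v j x)^*).
  by move=> cu cv; apply: ccontM; [exact: cu|apply: ccontJ; exact: cv].
split.
- by move=> j; exact: ccont_cst.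
- by move=> u v cu cv j; apply: ccontD.
- by move=> c u cu j; apply: ccontM => //; exact: ccont_cst.
- move=> u v w cu cv cw; rewrite /tip -big_split; apply: eq_bigr => j _ /=.
  by rewrite -cintD //; [congr cint; apply: funext => x; rewrite -mulrDl|exact: cJ|exact: cJ].
- move=> c u w cu cw; rewrite /tip mulr_sumr; apply: eq_bigr => j _.
  by rewrite -cintZ //; [congr cint; apply: funext => x; rewrite mulrA|exact: cJ].
- move=> u v cu cv; rewrite /tip rmorph_sum; apply: eq_bigr => j _ /=.
  rewrite -cintJ //; last exact: cJ.
  by congr cint; apply: funext => x; rewrite rmorphM /= conjCK mulrC.
- move=> u cu; rewrite /tip cRe_sum; apply: sumr_ge0 => j _.
  exact: Re_cint_ge0.
Qed.

Lemma tderiv_cont u du : tderiv u du -> tcont u.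
Proof. by move=> d j; apply: cderiv_ccont (d j). Qed.

Lemma tip_by_parts u du v dv : tderiv u du -> tderiv v dv ->
  tcont du -> tcont dv -> tip du v + tip u dv = bdry u v.
Proof.
move=> hu hv cdu cdv; rewrite /tip /bdry -big_split; apply: eq_bigr => j _ /=.
have cu := tderiv_cont hu; have cv := tderiv_cont hv.
rewrite -cintD //; last 2 first.
- by apply: ccontM; [exact: cdu|apply: ccontJ; exact: cv].
- by apply: ccontM; [exact: cu|apply: ccontJ; exact: cdv].
rewrite (@cint_FTC _ (fun x => u j x * (v j x)^*)) //.
- by apply: ccontD; apply: ccontM;
    do ?[exact: cdu|exact: cu|apply: ccontJ; exact: cv|apply: ccontJ; exact: cdv].
- by apply: cderivM; [exact: hu|apply: cderivJ; exact: hv].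
Qed.

Definition agree (f : R -> R[i]) (u : V) : Prop :=
  forall j x, alpha j 0 < x < beta j 0 -> f x = u j x.

Lemma agree_measurable f u : agree f u -> tcont u ->
  measurable_fun Omega (fun x => Re (f x)) /\ measurable_fun Omega (fun x => Im (f x)).
Proof.
move=> fu cu; split.
  apply: (@measurable_fun_glue _ (fun j x => Re (u j x))) => j; first exact: (cu j).1.
  by move=> x /fu ->.
apply: (@measurable_fun_glue _ (fun j x => Im (u j x))) => j; first exact: (cu j).2.
by move=> x /fu ->.
Qed.

Lemma L2inner_agree f g u v : agree f u -> agree g v -> tcont u -> tcont v ->
  L2inner Omega f g = tip u v.
Proof.
move=> fu gv cu cv.
have cJ j : ccont (fun x => u j x * (v j x)^*).
  by apply: ccontM; [exact: cu|apply: ccontJ; exact: cv].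
apply: complex_ext; rewrite /L2inner /cintegral /tip ?cRe_sum ?cIm_sum /=.
  rewrite /Rintegral (@integral_glue _ (fun j x => Re (u j x * (v j x)^*))) //.
    by move=> j; exact: (cJ j).1.
  by move=> j x xj; rewrite (fu j) // (gv j).
rewrite /Rintegral (@integral_glue _ (fun j x => Im (u j x * (v j x)^*))) //.
  by move=> j; exact: (cJ j).2.
by move=> j x xj; rewrite (fu j) // (gv j).
Qed.

End IntervalUnion.

(** * The L^2 norm in terms of tuples *)

Section L2norm.
Variable R : realType.
Local Notation mu := (@lebesgue_measure R).

Lemma L2normE (D : set R) (f : R -> R[i]) :
  L2norm D f = ((\int[mu]_(x in D) (sqmod (f x))%:E) `^ 2^-1)%E.
Proof.
rewrite /L2norm unlock; congr (_ `^ _)%E.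
rewrite [RHS]integral_mkcond; apply: eq_integral => x _ /=.
rewrite !patchE; case: ifPn => _; last by rewrite normr0 powR0.
by rewrite ger0_norm ?cmodulus_ge0 // powR_mulrn ?cmodulus_ge0 // sqmod_cmodulus.
Qed.

End L2norm.

Section L2normAgree.
Variables (R : realType) (n : nat) (alpha beta : 'cV[R]_n).
Hypothesis alpha_lt_beta : forall i : 'I_n, alpha i 0 < beta i 0.
Hypothesis beta_lt_alpha : forall i j : 'I_n, j = i.+1 :> nat ->
  beta i 0 < alpha j 0.
Local Notation Omega := (interval_union alpha beta).

Lemma L2norm_agree f u : agree alpha beta f u -> tcont u ->
  L2norm Omega f = (Num.sqrt (sqn (tip alpha beta) u))%:E.
Proof.
move=> fu cu.
rewrite L2normE (@integral_glue _ _ _ _ alpha_lt_beta beta_lt_alpha _ (fun j x => sqmod (u j x))).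
- rewrite poweR_EFin; congr (_%:E).
  have -> : \sum_(j < n) \int[@lebesgue_measure R]_(x in `[alpha j 0, beta j 0]) sqmod (u j x)
     = sqn (tip alpha beta) u.
    by rewrite sqn_sum; apply: eq_bigr => j _; rewrite Re_cint_sqmod.
  by rewrite powR12_sqrt //; apply: sqn_ge0 (tip_prehilbert alpha_lt_beta) _ cu.
- by move=> j; apply: ccont_sqmod.
- by move=> j x /fu ->.
Qed.

Lemma inL2_agree f u : agree alpha beta f u -> tcont u -> inL2 Omega f.
Proof.
move=> fu cu; have [m1 m2] := agree_measurable fu cu.
by split=> //; rewrite (L2norm_agree fu cu) ltry.
Qed.

End L2normAgree.

(** * Density of the functions vanishing at the endpoints *)

Section ContinuousApproximation.
Variable R : realType.
Implicit Types (f g k : R -> R) (a b M eps : R).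
Local Notation mu := (@lebesgue_measure R).

Lemma is_derive_pow N f (x u : R) : is_derive x 1 f u ->
  is_derive x 1 (fun y => f y ^+ N) (N%:R * f x ^+ N.-1 * u).
Proof.
move=> df; elim: N => [|N IH]; first by rewrite !mul0r; exact: is_derive_const.
under eq_fun do rewrite exprS.
apply: (@is_derive_eq _ _ _ _ _ _ _ _ (is_derive_mul df IH)).
by case: N {IH} => [|N]; rewrite ?expr0 ?mul0r ?mulr0 ?addr0 ?mulr1 ?mul1r //=
  exprS (mulrS _ N.+1); ring.
Qed.

Lemma continuous_pow N f : continuous f -> continuous (fun x => f x ^+ N).
Proof.
move=> cf x; apply: (@continuous_comp _ _ _ f (fun y => y ^+ N)); first exact: cf.
exact: exprn_continuous.
Qed.

(** Truncation to [[- M, M]], written with absolute values so that continuity is immediate. *)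
Definition clip M (y : R) : R := (`|y + M| - `|y - M|) / 2.

Lemma clipE M y : 0 <= M -> clip M y = if y <= - M then - M else if y <= M then y else M.
Proof.
move=> M0; rewrite /clip; case: (lerP y (- M)) => h.
  by rewrite !ler0_norm; lra.
case: (lerP y M) => h'; rewrite [`|y + M|]ger0_norm; try lra.
Qed.

Lemma clip_id M y : `|y| <= M -> clip M y = y.
Proof.
move=> yM; have M0 := le_trans (normr_ge0 _) yM; move: yM.
rewrite ler_norml => /andP[h1 h2]; rewrite clipE // h2.
by case: ifP => // h3; lra.
Qed.

Lemma clip_bound M y : 0 <= M -> `|clip M y| <= M.
Proof.
move=> M0; rewrite clipE // ler_norml.
by case: (lerP y (- M)) => ?; [|case: (lerP y M) => ?]; apply/andP; split; lra.
Qed.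

Lemma clip_residual M y : 0 <= M -> (y - clip M y) ^+ 2 <= y ^+ 2.
Proof.
move=> M0; rewrite clipE //.
by case: (lerP y (- M)) => ?; [|case: (lerP y M) => ?]; nra.
Qed.

Lemma clip_lipschitz M y z : 0 <= M -> `|clip M y - clip M z| <= `|y - z|.
Proof.
move=> M0; have := ler_norm (y - z); have := ler_norm (- (y - z)).
rewrite normrN !clipE // => h1 h2; rewrite ler_norml.
by case: (lerP y (- M)) => ?; [|case: (lerP y M) => ?];
  (case: (lerP z (- M)) => ?; [|case: (lerP z M) => ?]); apply/andP; split; lra.
Qed.

Lemma continuous_clip M : continuous (clip M).
Proof.
move=> y; apply: cvgMl; apply: cvgB; apply: cvg_norm.
  by apply: cvgD; [exact: cvg_id|exact: cvg_cst].
by apply: cvgB; [exact: cvg_id|exact: cvg_cst].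
Qed.

Section SquareIntegrable.
Variables (D : set R) (f : R -> R).
Hypotheses (mD : measurable D) (Dfin : (mu D < +oo)%E) (mf : measurable_fun D f)
  (f2 : (\int[mu]_(x in D) (f x ^+ 2)%:E < +oo)%E).

Let mclip M g : measurable_fun D g -> measurable_fun D (fun x => clip M (g x)).
Proof.
move=> mg; apply: (@measurableT_comp _ _ _ _ _ _ (clip M)) => //.
by apply: continuous_measurable_fun; exact: continuous_clip.
Qed.

Let msq g : measurable_fun D g -> measurable_fun D (fun x => (g x ^+ 2)%:E).
Proof. by move=> mg; apply/measurable_EFinP; exact: measurable_funX. Qed.

(** Dominated convergence: at each point the residual is eventually 0, and [f ^+ 2] dominates it. *)
Lemma square_integrable_clip eps : 0 < eps -> exists N : nat,
  (\int[mu]_(x in D) ((f x - clip N%:R (f x)) ^+ 2)%:E < eps%:E)%E.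
Proof.
move=> eps0.
have mr N : measurable_fun D (fun x => ((f x - clip N%:R (f x)) ^+ 2)%:E).
  by apply: msq; apply: measurable_funB => //; exact: mclip.
have [||||_ _ h] := @dominated_convergence _ _ _ mu D mD
  (fun N x => ((f x - clip N%:R (f x)) ^+ 2)%:E) (cst 0%E) (fun x => (f x ^+ 2)%:E) mr.
- exact: measurable_cst.
- apply: aeW => x Dx; apply: cvg_near_cst; near=> N.
  rewrite clip_id ?subrr ?expr0n //; near: N; exact: nbhs_infty_ger.
- apply/integrableP; split; first exact: msq.
  by under eq_integral do rewrite gee0_abs ?lee_fin ?sqr_ge0 //.
- by apply: aeW => x N Dx /=; rewrite lee_fin ger0_norm ?sqr_ge0 // clip_residual.
move: h; rewrite integral0 => /(_ _ (nbhs_open_ereal_lt (f := fun=> eps) eps0)) [N _ hN].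
by exists N; have := hN N (leqnn N).
Unshelve. all: by end_near. Qed.

(** Density of continuous functions is known in L^1. Between functions bounded by [N] the squared
    distance is at most [2 * N] times the distance, so truncating both [f] and its L^1 approximant
    at [N] gives closeness in L^2. [M] exceeds [N] by 1 only to be positive. *)
Lemma square_integrable_continuous eps : 0 < eps -> exists2 g, continuous g &
  (\int[mu]_(x in D) ((f x - g x) ^+ 2)%:E < eps%:E)%E.
Proof.
move=> eps0; have e4 : 0 < eps / 4 by lra.
have [N hN] := square_integrable_clip e4; pose M : R := N%:R + 1.
have M0 : 0 <= N%:R :> R by rewrite ler0n.
have M1 : 0 < M by rewrite /M; lra.
set c := fun x => clip N%:R (f x).
have mc : measurable_fun D c by exact: mclip.
have ic : mu.-integrable D (EFin \o c).
  apply: measurable_bounded_integrable => //; exists N%:R.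
  split=> [|y Ny x Dx]; first exact: num_real.
  by apply: le_trans (clip_bound _ M0) (ltW Ny).
have [g_ [cg _ hg]] := approximation_continuous_integrable mD Dfin ic.
have e5 : 0 < eps / (8 * M) by rewrite divr_gt0 ?mulr_gt0.
move/(_ _ (nbhs_open_ereal_lt (f := fun=> eps / (8 * M)) e5)): hg => [k _ /(_ k (leqnn k)) /= hk].
set d := fun x => clip N%:R (g_ k x).
have cd : continuous d.
  by move=> x; apply: (@continuous_comp _ _ _ (g_ k) (clip N%:R));
    [exact: cg|exact: continuous_clip].
have md : measurable_fun D d by apply: measurable_funTS; exact: continuous_measurable_fun.
exists d => //.
have mgk : measurable_fun D (g_ k) by apply: measurable_funTS; exact: continuous_measurable_fun.
have m1 : measurable_fun D (fun x => ((f x - c x) ^+ 2)%:E) by apply: msq; exact: measurable_funB.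
have m2 : measurable_fun D (fun x => `|(c x - g_ k x)%:E|%E).
  by apply: measurableT_comp => //; apply/measurable_EFinP; exact: measurable_funB.
have h1 : (\int[mu]_(x in D) ((f x - d x) ^+ 2)%:E <=
   \int[mu]_(x in D) (2%:E * ((f x - c x) ^+ 2)%:E + (4 * M)%:E * `|(c x - g_ k x)%:E|))%E.
  apply: ge0_le_integral => //.
  - by move=> x _; rewrite lee_fin sqr_ge0.
  - by apply: msq; exact: measurable_funB.
  - by apply: emeasurable_funD; apply: measurable_funeM.
  move=> x Dx; rewrite -!EFinM -EFinD lee_fin.
  have b1 := clip_bound (f x) M0; have b2 := clip_bound (g_ k x) M0.
  have b3 : `|c x - d x| <= `|c x - g_ k x|.
    by have h : clip N%:R (c x) = c x := clip_id b1; rewrite -{1}h; exact: clip_lipschitz.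
  rewrite -/(c x) -/(d x) in b1 b2.
  have b4 : (c x - d x) ^+ 2 <= 2 * M * `|c x - g_ k x|.
    rewrite -real_normK ?num_real // expr2 ler_pM //.
    by apply: le_trans (ler_normB _ _) _; rewrite /M; lra.
  have -> : f x - d x = (f x - c x) + (c x - d x) by ring.
  have := sqr_ge0 ((f x - c x) - (c x - d x)); move: b4.
  by move: (f x - c x) (c x - d x) (`|_|) => p q r; nra.
apply: (le_lt_trans h1); rewrite ge0_integralD //; last 4 first.
- by move=> x _; rewrite mule_ge0 // lee_fin sqr_ge0.
- exact: measurable_funeM.
- by move=> x _; rewrite mule_ge0 // lee_fin; lra.
- exact: measurable_funeM.
have M4 : 0 <= 4 * M by lra.
rewrite !ge0_integralZl_EFin //; last by move=> x _; rewrite lee_fin sqr_ge0.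
apply: (@lt_le_trans _ _ (2%:E * (eps / 4)%:E + (4 * M)%:E * (eps / (8 * M))%:E)%E).
  by apply: lteD; rewrite lte_pmul2l // lte_fin; lra.
rewrite -!EFinM -EFinD lee_fin.
by rewrite (_ : 4 * M * _ = eps / 2); [lra | field; rewrite gt_eqF].
Qed.

End SquareIntegrable.

(** The point [y] may lie beyond [b], because [mollify] compares [k x] with values of [k] on
    [[x, x + h]]. *)
Lemma uniformly_continuous_itv k a b eps : continuous k -> 0 < eps ->
  exists2 h, 0 < h & forall x y, a <= x <= b -> x <= y <= x + h -> `|k y - k x| <= eps.
Proof.
move=> ck eps0.
have /compact_near_coveringP cov := @segment_compact R a b.
have : \forall h \near 0^'+, `[a, b]%classic `<=`
    [set x | forall y, x <= y <= x + h -> `|k y - k x| <= eps].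
  apply: cov => x _.
  have e2 : 0 < eps / 2 by rewrite divr_gt0.
  have /cvgrPdist_lt/(_ _ e2)/nbhs_ballP [d /= d0 hd] := ck x.
  have hd' y : `|x - y| < d -> `|k x - k y| < eps / 2 by exact: hd.
  have d2 : 0 < d / 2 by rewrite divr_gt0.
  exists (ball x (d / 2), [set h : R | h < d / 2]) => /=.
    split; first exact: nbhsx_ballx.
    by near=> h; near: h; exact: nbhs_right_lt.
  move=> [z h] /= [xz hd2] y /andP[zy yh].
  move: xz; rewrite /ball /= => xz.
  have k1 : `|k x - k z| < eps / 2 by apply: hd'; lra.
  have k2 : `|k x - k y| < eps / 2.
    by apply: hd'; move: xz; rewrite !ltr_norml => /andP[? ?]; apply/andP; split; lra.
  rewrite (_ : k y - k z = (k x - k z) - (k x - k y)); last by ring.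
  by apply: le_trans (ler_normB _ _) _; lra.
move=> hh; have : \forall h \near (0 : R)^'+, 0 < h by exact: nbhs_right_gt.
move=> /filterI /(_ hh) /filter_ex [h [h0 hs]].
by exists h => // x y xab; apply: hs; rewrite /= in_itv.
Unshelve. all: by end_near. Qed.

(** Take the average of [k] over [[x, x + h]]: its derivative is a difference quotient of [k], and
    by the mean value theorem it is a value of [k] near [x]. *)
Lemma mollify k a b eps : continuous k -> 0 < eps -> exists w w',
  [/\ forall x : R, is_derive x 1 w (w' x), continuous w' &
      forall x, a <= x <= b -> `|k x - w x| <= eps].
Proof.
move=> ck eps0; have [h h0 hk] := uniformly_continuous_itv a b ck eps0.
have [K dK] := antiderivative ck.
have cs : continuous (fun x => k (x + h)).
  by move=> x; apply: continuous_comp; [apply: cvgD; [exact: cvg_id|exact: cvg_cst]|exact: ck].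
exists (fun x => h^-1 * (K (x + h) - K x)), (fun x => h^-1 * (k (x + h) - k x)); split.
- move=> x; apply: is_derive_scale; apply: is_derive_sub => //.
  have := @is_derive1_comp _ K (fun y => y + h) x _ _ (dK _)
    (is_derive_add (is_derive_ident x) (is_derive_const h x)).
  by rewrite addr0 mulr1.
- by move=> x; apply: cvgMr; apply: cvgB; [exact: cs|exact: ck].
- move=> x xab.
  have xh : x <= x + h by lra.
  have [|z] := @MVT_segment R K k x (x + h) xh.
    by apply: continuous_subspaceT; exact: is_derive_continuous dK.
  rewrite in_itv /= => zx ->.
  have -> : h^-1 * (k z * (x + h - x)) = k z by field; rewrite gt_eqF.
  by rewrite distrC; apply: hk.
Qed.

(* The correction [p ((b - x) / (b - a)) ^+ m + q ((x - a) / (b - a)) ^+ m] has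
   boundary values [p], [q] and squared norm [O(1 / m)]. *)
Lemma approx_vanishing_boundary k a b eps : a < b -> continuous k -> 0 < eps ->
  exists w w', [/\ forall x : R, is_derive x 1 w (w' x), continuous w',
    w a = 0, w b = 0 & \int[mu]_(x in `[a, b]) ((k x - w x) ^+ 2) <= eps].
Proof.
move=> ab ck eps0; pose L := b - a; have L0 : 0 < L by rewrite subr_gt0.
(* The minimum with 1 gives [e ^+ 2 <= e]. Since [(X + Y + Z) ^+ 2 <= 3 * (X ^+ 2 + Y ^+ 2 + Z ^+
   2)], the mollification error costs at most [3 * e ^+ 2 * L <= eps / 2], and [N > s] leaves at
   most [eps / 2] for the two corrections. *)
pose e := Num.min 1 (eps / (6 * L)).
have e0 : 0 < e by rewrite lt_min ltr01 divr_gt0 // mulr_gt0.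
have e1 : e ^+ 2 <= eps / (6 * L).
  have h1 : e <= 1 by rewrite ge_min lexx.
  have h2 : e <= eps / (6 * L) by rewrite ge_min lexx orbT.
  by apply: le_trans h2; rewrite expr2 ler_piMl // ltW.
have [v [v' [dv cv' hv]]] := mollify a b ck e0.
set p := v a; set q := v b; pose s := 6 * (p ^+ 2 + q ^+ 2) * L / eps.
pose N := (Num.truncn s).+1; have sN : s < N%:R by exact: truncnS_gt.
have Lu : L^-1 * L = 1 by rewrite mulVf // gt_eqF.
pose l1 x := L^-1 * (b - x); pose l2 x := L^-1 * (x - a).
have dl1 (x : R) : is_derive x 1 l1 (- L^-1).
  by apply: is_derive_eq; rewrite /GRing.scale /=; ring.
have dl2 (x : R) : is_derive x 1 l2 L^-1.
  by apply: is_derive_eq; rewrite /GRing.scale /=; ring.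
have cl1 := is_derive_continuous dl1; have cl2 := is_derive_continuous dl2.
have l1a : l1 a = 1 by []; have l2b : l2 b = 1 by [].
have l1b : l1 b = 0 by rewrite /l1 subrr mulr0.
have l2a : l2 a = 0 by rewrite /l2 subrr mulr0.
pose w x := v x - p * l1 x ^+ N - q * l2 x ^+ N.
pose w' x := v' x - p * (N%:R * l1 x ^+ N.-1 * - L^-1) - q * (N%:R * l2 x ^+ N.-1 * L^-1).
have dw (x : R) : is_derive x 1 w (w' x).
  by apply: is_derive_sub; [apply: is_derive_sub|]; rewrite //;
    apply: is_derive_scale; exact: is_derive_pow.
exists w, w'; split => //.
- move=> x; apply: cvgB; [apply: cvgB; first exact: cv'|]; apply: cvgMr; apply: cvgMl;
    apply: cvgMr; exact: continuous_pow.
- by rewrite /w l1a l2a expr1n expr0n /= /p; ring.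
- by rewrite /w l1b l2b expr1n expr0n /= /q; ring.
have cd : continuous (fun x => (k x - w x) ^+ 2).
  move=> x; under eq_fun do rewrite expr2.
  have cw := is_derive_continuous dw.
  by apply: cvgM; (apply: cvgB; [exact: ck|exact: cw]).
have [P dP] := antiderivative cd; rewrite (Rintegral_FTC ab cd dP).
pose D : R := (2 * N).+1%:R; have D0 : D != 0 by rewrite pnatr_eq0.
(* An antiderivative of [3 * (e ^+ 2 + p ^+ 2 * l1 x ^+ (2 * N) + q ^+ 2 * l2 x ^+ (2 * N))], which
   bounds [(k x - w x) ^+ 2] on the interval. *)
pose G x := 3 * (e ^+ 2 * x + p ^+ 2 * (- L / D * l1 x ^+ (2 * N).+1) +
  q ^+ 2 * (L / D * l2 x ^+ (2 * N).+1)).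
have dG (x : R) : is_derive x 1 G
    (3 * (e ^+ 2 * 1 + p ^+ 2 * (- L / D * (D * l1 x ^+ (2 * N) * - L^-1)) +
      q ^+ 2 * (L / D * (D * l2 x ^+ (2 * N) * L^-1)))).
  have d0 := is_derive_scale (e ^+ 2) (is_derive_ident x).
  have d1 := is_derive_scale (p ^+ 2)
    (is_derive_scale (- L / D) (is_derive_pow (2 * N).+1 (dl1 x))).
  have d2 := is_derive_scale (q ^+ 2) (is_derive_scale (L / D) (is_derive_pow (2 * N).+1 (dl2 x))).
  exact: is_derive_scale (is_derive_add (is_derive_add d0 d1) d2).
have dGP (x : R) := is_derive_sub (dG x) (dP x).
have fe (l : R) : L / D * (D * l * L^-1) = l.
  rewrite (_ : _ * _ = (L^-1 * L) * (D^-1 * D) * l); last by ring.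
  by rewrite Lu mulVf // !mul1r.
have : G a - P a <= G b - P b.
  apply: (is_derive_ge0_le dGP) (ltW ab) => x /hv kv.
  have -> : - L / D * (D * l1 x ^+ (2 * N) * - L^-1) = l1 x ^+ N ^+ 2.
    by rewrite mulnC exprM mulNr mulrN mulNr mulrN opprK fe.
  have -> : L / D * (D * l2 x ^+ (2 * N) * L^-1) = l2 x ^+ N ^+ 2.
    by rewrite mulnC exprM fe.
  have e2 : (k x - v x) ^+ 2 <= e ^+ 2.
    by rewrite -real_normK ?num_real // ler_pXn2r ?nnegrE ?(ltW e0).
  rewrite (_ : k x - w x = (k x - v x) + p * l1 x ^+ N + q * l2 x ^+ N); last by rewrite /w; ring.
  move: e2; rewrite -!exprMn; move: (k x - v x) (p * _) (q * _) => X Y Z.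
  rewrite mulr1 => e2.
  have := sqr_ge0 (X - Y); have := sqr_ge0 (X - Z); have := sqr_ge0 (Y - Z).
  by rewrite /= => ? ? ?; nra.
have -> : G b = 3 * (e ^+ 2 * b + q ^+ 2 * (L / D)).
  by rewrite /G l1b l2b expr1n expr0n /=; ring.
have -> : G a = 3 * (e ^+ 2 * a - p ^+ 2 * (L / D)).
  by rewrite /G l1a l2a expr1n expr0n /=; ring.
have : (p ^+ 2 + q ^+ 2) * (L / D) <= eps / 6.
  have DN : N%:R <= D by rewrite ler_nat (leq_trans (leq_pmull N (isT : 0 < 2)%N)).
  have : s <= D by lra.
  have D1 : 0 < D by rewrite ltr0n.
  rewrite /s ler_pdivrMr // => h.
  by rewrite mulrA ler_pdivrMr //; nra.
have : 3 * (e ^+ 2 * L) <= eps / 2.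
  by move: e1; rewrite ler_pdivlMr ?mulr_gt0 //; lra.
have -> : e ^+ 2 * L = e ^+ 2 * b - e ^+ 2 * a by rewrite /L mulrBr.
have key (A B E F X Y : R) : 3 * (F - E) <= eps / 2 -> A + B <= eps / 6 ->
  3 * (E - A) - X <= 3 * (F + B) - Y -> Y - X <= eps by lra.
rewrite [(p ^+ 2 + _) * _]mulrDl; exact: key.
Qed.

End ContinuousApproximation.

Section Density.
Variables (R : realType) (n : nat) (alpha beta : 'cV[R]_n).
Hypothesis alpha_lt_beta : forall i : 'I_n, alpha i 0 < beta i 0.
Hypothesis beta_lt_alpha : forall i j : 'I_n, j = i.+1 :> nat ->
  beta i 0 < alpha j 0.
Local Notation mu := (@lebesgue_measure R).
Local Notation Omega := (interval_union alpha beta).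
Local Notation V := ('I_n -> R -> (R[i])^o).
Local Notation tip := (tip alpha beta).
Local Notation sqn := (sqn tip).
Let TP := tip_prehilbert alpha_lt_beta.

Lemma measurable_fun_sqmod (D : set R) (f : R -> R[i]) :
  measurable_fun D (fun x => Re (f x)) -> measurable_fun D (fun x => Im (f x)) ->
  measurable_fun D (fun x => (sqmod (f x))%:E).
Proof.
move=> m1 m2; apply/measurable_EFinP; apply: measurable_funD; exact: measurable_funX.
Qed.

Lemma L2norm_ltP (D : set R) (f : R -> R[i]) eps : 0 < eps ->
  (\int[mu]_(x in D) (sqmod (f x))%:E < (eps ^+ 2)%:E)%E ->
  (L2norm D f < eps%:E)%E.
Proof.
move=> eps0; rewrite L2normE.
have : (0 <= \int[mu]_(x in D) (sqmod (f x))%:E)%E.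
  by apply: integral_ge0 => x _; rewrite lee_fin sqmod_ge0.
case: (\int[mu]_(x in D) _)%E => [r||] //.
rewrite lee_fin lte_fin poweR_EFin lte_fin => r0 rlt; rewrite powR12_sqrt //.
by rewrite -(ger0_norm (ltW eps0)) -sqrtr_sqr ltr_sqrt // exprn_gt0.
Qed.

Lemma inL2_integral (D : set R) (f : R -> R[i]) : inL2 D f ->
  (\int[mu]_(x in D) (sqmod (f x))%:E < +oo)%E.
Proof.
case=> _ _; rewrite L2normE.
case: (\int[mu]_(x in D) _)%E => [r||] //; first by move=> _; rewrite ltry.
by rewrite poweRyr ?ltxx // invr_eq0 pnatr_eq0.
Qed.

Lemma inL2_approx_continuous (f : R -> R[i]) eps : inL2 Omega f -> 0 < eps ->
  exists2 g, ccont g &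
  (\int[mu]_(x in Omega) (sqmod (f x - g x))%:E < eps%:E)%E.
Proof.
move=> fL eps0; have [m1 m2 _] := fL; have h := inL2_integral fL.
have mO := measurable_interval_union alpha beta.
have Ofin : (mu Omega < +oo)%E.
  by rewrite (lebesgue_interval_union alpha_lt_beta beta_lt_alpha) ltry.
have e2 : 0 < eps / 2 by rewrite divr_gt0.
have ms := measurable_fun_sqmod m1 m2.
have h1 : (\int[mu]_(x in Omega) (Re (f x) ^+ 2)%:E < +oo)%E.
  apply: le_lt_trans h; apply: ge0_le_integral => //.
  - by move=> x _; rewrite lee_fin sqr_ge0.
  - by apply/measurable_EFinP; exact: measurable_funX.
  - by move=> x _; rewrite lee_fin /sqmod lerDl sqr_ge0.
have h2 : (\int[mu]_(x in Omega) (Im (f x) ^+ 2)%:E < +oo)%E.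
  apply: le_lt_trans h; apply: ge0_le_integral => //.
  - by move=> x _; rewrite lee_fin sqr_ge0.
  - by apply/measurable_EFinP; exact: measurable_funX.
  - by move=> x _; rewrite lee_fin /sqmod lerDr sqr_ge0.
have [g1 cg1 hg1] := square_integrable_continuous mO Ofin m1 h1 e2.
have [g2 cg2 hg2] := square_integrable_continuous mO Ofin m2 h2 e2.
exists (fun x => Complex (g1 x) (g2 x)) => //.
under eq_integral do rewrite /sqmod !cpartsE EFinD.
have mg (g : R -> R) : continuous g -> measurable_fun Omega g.
  by move=> cg; apply: measurable_funTS; exact: continuous_measurable_fun.
rewrite ge0_integralD //.
- by rewrite (splitr eps) EFinD; exact: lteD.
- by move=> x _; rewrite lee_fin sqr_ge0.
- apply/measurable_EFinP; apply: measurable_funX; apply: measurable_funB => //; exact: mg.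
- by move=> x _; rewrite lee_fin sqr_ge0.
- apply/measurable_EFinP; apply: measurable_funX; apply: measurable_funB => //; exact: mg.
Qed.

Lemma tuple_sumE I (r : seq I) (F : I -> V) j x :
  (\sum_(i <- r) F i) j x = \sum_(i <- r) F i j x.
Proof. by elim: r => [|i r IH]; rewrite ?big_nil // !big_cons -IH. Qed.

Definition tvanish (w : V) : Prop :=
  forall j, w j (alpha j 0) = 0 /\ w j (beta j 0) = 0.

Lemma tcont_approx_vanish (u : V) eps : tcont u -> 0 < eps -> exists w dw,
  [/\ tderiv w dw, tcont dw, tvanish w & sqn (u - w) <= eps].
Proof.
(* There are [n] intervals with a real and an imaginary part on each; [n.+1] keeps the denominator
   positive. *)
move=> cu eps0; pose e := eps / (2 * n.+1%:R).
have e0 : 0 < e by rewrite divr_gt0 // mulr_gt0 // ltr0n.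
have H1 (j : 'I_n) : exists p : (R -> R) * (R -> R),
  [/\ forall x : R, is_derive x 1 p.1 (p.2 x), continuous p.2,
    p.1 (alpha j 0) = 0, p.1 (beta j 0) = 0 &
    \int[mu]_(x in `[alpha j 0, beta j 0]) ((Re (u j x) - p.1 x) ^+ 2) <= e].
  have [w [w' h]] := approx_vanishing_boundary (alpha_lt_beta j) (cu j).1 e0.
  by exists (w, w').
have H2 (j : 'I_n) : exists p : (R -> R) * (R -> R),
  [/\ forall x : R, is_derive x 1 p.1 (p.2 x), continuous p.2,
    p.1 (alpha j 0) = 0, p.1 (beta j 0) = 0 &
    \int[mu]_(x in `[alpha j 0, beta j 0]) ((Im (u j x) - p.1 x) ^+ 2) <= e].
  have [w [w' h]] := approx_vanishing_boundary (alpha_lt_beta j) (cu j).2 e0.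
  by exists (w, w').
have [p hp] := choice H1; have [q hq] := choice H2.
pose w : V := fun j x => Complex ((p j).1 x) ((q j).1 x).
pose dw : V := fun j x => Complex ((p j).2 x) ((q j).2 x).
have dW : tderiv w dw.
  by move=> j x; split; [have [d _ _ _ _] := hp j|have [d _ _ _ _] := hq j]; exact: d.
exists w, dw; split => //.
- by move=> j; split; [have [_ d _ _ _] := hp j|have [_ d _ _ _] := hq j]; exact: d.
- move=> j; have [_ _ a1 b1 _] := hp j; have [_ _ a2 b2 _] := hq j.
  by rewrite /w a1 a2 b1 b2.
have bound (j : 'I_n) : Re (cint (alpha j 0) (beta j 0)
    (fun x => (u - w) j x * ((u - w) j x)^*)) <= 2 * e.
  rewrite Re_cint_sqmod.
  have [d1 _ _ _ i1] := hp j; have [d2 _ _ _ i2] := hq j.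
  have csq (k v : R -> R) : continuous k -> continuous v ->
      mu.-integrable `[alpha j 0, beta j 0] (EFin \o (fun x => (k x - v x) ^+ 2)).
    move=> ck cv; apply: continuous_integrable_itv; apply: continuous_pow => x.
    by apply: cvgB; [exact: ck|exact: cv].
  rewrite (_ : (fun x => sqmod _) = fun x => (Re (u j x) - (p j).1 x) ^+ 2 +
    (Im (u j x) - (q j).1 x) ^+ 2); last first.
    by apply: funext => x; rewrite /sqmod !cpartsE.
  rewrite RintegralD //; first by lra.
    by apply: csq; [exact: (cu j).1|exact: is_derive_continuous d1].
  by apply: csq; [exact: (cu j).2|exact: is_derive_continuous d2].
rewrite sqn_sum; apply: (le_trans (ler_sum _ (fun j _ => bound j))).
rewrite sumr_const card_ord -[_ *+ n]mulr_natr /e.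
have n0 : 0 < n.+1%:R :> R by rewrite ltr0n.
have nn : n%:R <= n.+1%:R :> R by rewrite ler_nat.
move: n0 nn; move: (n.+1%:R) (n%:R) => d d' d0 dd.
rewrite (_ : 2 * (eps / (2 * d)) * d' = eps * (d' / d)); last by field; rewrite gt_eqF.
by rewrite ler_piMr ?(ltW eps0) // ler_pdivrMr // mul1r.
Qed.

Definition texp (t : R) : V := fun=> echar t.

(** Approximate [f] by a continuous [g], then [g] by a [w] vanishing at the endpoints. Such a [w]
    satisfies every condition [B u(alpha) = u(beta)], so only functions in the domain of the
    operator remain to be approximated. *)
Lemma L2total_criterion (Lambda : set R) : (0 < n)%N ->
  (forall w dw, tderiv w dw -> tcont dw -> tvanish w -> forall eps : R, 0 < eps ->
   exists (m : nat) (c : 'I_m -> R[i]) (l : 'I_m -> R),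
     (forall k, Lambda (l k)) /\ sqn (w - \sum_k c k *: texp (l k)) < eps) ->
  L2total Omega [set normalized_echar Omega l | l in Lambda].
Proof.
move=> n0 H f fL eps eps0.
(* The inequality [|x + y|^2 <= 2 |x|^2 + 2 |y|^2] is used twice, for [u - w - P] and then for
   [f - g - p]. *)
have e4 : 0 < eps ^+ 2 / 4 by rewrite divr_gt0 ?exprn_gt0.
have e16 : 0 < eps ^+ 2 / 16 by rewrite divr_gt0 ?exprn_gt0.
have [g cg hg] := inL2_approx_continuous fL e4.
pose u : V := fun=> g; have cu : tcont u by move=> j.
have [w [dw [dW cdw vw uw]]] := tcont_approx_vanish cu e16.
have [m [c [l [lL wl]]]] := H _ _ dW cdw vw _ e16.
have Sm : 0 < Num.sqrt (fine (mu Omega)).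
  by rewrite sqrtr_gt0; exact: measure_interval_union_gt0.
set S := Num.sqrt _ in Sm.
exists m, (fun k => normalized_echar Omega (l k)), (fun k => c k * S%:C); split.
  by move=> k; exists (l k).
apply: L2norm_ltP => //.
set p : R -> R[i] := fun x => \sum_(k < m) c k * S%:C * normalized_echar Omega (l k) x.
pose P : V := \sum_k c k *: texp (l k).
have Pp j x : P j x = p x.
  rewrite /P /p tuple_sumE.
  apply: eq_bigr => k _.
  rewrite /normalized_echar -/S.
  rewrite mulrA -[c k * S%:C * _]mulrA -rmorphM /= divff ?gt_eqF // mulr1.
  by [].
have cw : tcont w by exact: tderiv_cont dW.
have cP : tcont P.
  apply: (ph_sum TP) => k; apply: (phZ TP) => j.
  have := @cderiv_cexp R (two_pi_i R * (l k)%:C) => /cderiv_ccont.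
  by rewrite /texp /echar; under eq_fun do rewrite -mulrA -rmorphM.
have cuP : tcont (u - P) by exact: phB TP _ _ cu cP.
have huP : sqn (u - P) < eps ^+ 2 / 4.
  have cuw : tcont (u - w) by exact: phB TP _ _ cu cw.
  have cwP : tcont (w - P) by exact: phB TP _ _ cw cP.
  have := sqnD_le TP cuw cwP; rewrite addrA subrK => /le_lt_trans; apply.
  by move: uw wl; rewrite -/P; lra.
have ag : agree alpha beta (fun x => g x - p x) (u - P) by move=> j x _; rewrite -(Pp j).
have [mgp1 mgp2] := agree_measurable ag cuP.
have igp : (\int[mu]_(x in Omega) (sqmod (g x - p x))%:E = (sqn (u - P))%:E)%E.
  rewrite (@integral_glue _ _ _ _ alpha_lt_beta beta_lt_alpha _ (fun j x => sqmod ((u - P) j x))).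
  - by congr (_%:E); rewrite sqn_sum; apply: eq_bigr => j _; rewrite Re_cint_sqmod.
  - by move=> j; apply: ccont_sqmod.
  - by move=> j x xj; rewrite -(ag j).
have mO := measurable_interval_union alpha beta.
have [m1 m2 _] := fL.
have [mg1 mg2] : measurable_fun Omega (fun x => Re (g x)) /\ measurable_fun Omega (fun x => Im (g x)).
  by split; apply: measurable_funTS; apply: continuous_measurable_fun; [exact: cg.1|exact: cg.2].
have mfg : measurable_fun Omega (fun x => (sqmod (f x - g x))%:E).
  apply: measurable_fun_sqmod.
    by under eq_fun do rewrite cReD cReN; exact: measurable_funB.
  by under eq_fun do rewrite cImD cImN; exact: measurable_funB.
have mgp : measurable_fun Omega (fun x => (sqmod (g x - p x))%:E) by exact: measurable_fun_sqmod.
have mfp : measurable_fun Omega (fun x => (sqmod (f x - p x))%:E).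
  apply: measurable_fun_sqmod.
    rewrite (_ : (fun x => _) = fun x => (Re (f x) - Re (g x)) + Re (g x - p x)).
      by apply: measurable_funD => //; exact: measurable_funB.
    by apply: funext => x; rewrite !cpartsE; ring.
  rewrite (_ : (fun x => _) = fun x => (Im (f x) - Im (g x)) + Im (g x - p x)).
    by apply: measurable_funD => //; exact: measurable_funB.
  by apply: funext => x; rewrite !cpartsE; ring.
apply: (@le_lt_trans _ _ (\int[mu]_(x in Omega) (2%:E * (sqmod (f x - g x))%:E +
    2%:E * (sqmod (g x - p x))%:E))%E).
  apply: ge0_le_integral => //.
  - by move=> x _; rewrite lee_fin sqmod_ge0.
  - by apply: emeasurable_funD; exact: measurable_funeM.
  move=> x _; rewrite -!EFinM -EFinD lee_fin.
  by rewrite -[f x - p x](subrKA (g x)); exact: sqmodD_le.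
rewrite ge0_integralD //.
- rewrite !ge0_integralZl_EFin ?igp //; try by move=> x _; rewrite lee_fin sqmod_ge0.
  apply: (@lt_le_trans _ _ (2%:E * (eps ^+ 2 / 4)%:E + 2%:E * (eps ^+ 2 / 4)%:E)%E).
    by apply: lteD; rewrite lte_pmul2l.
  by rewrite -!EFinM -EFinD lee_fin; lra.
- by move=> x _; rewrite mule_ge0 // lee_fin sqmod_ge0.
- exact: measurable_funeM.
- by move=> x _; rewrite mule_ge0 // lee_fin sqmod_ge0.
- exact: measurable_funeM.
Qed.

End Density.

(** * Exponentials and boundary values *)

Section Exponentials.
Variable R : realType.
Implicit Types (z w : R[i]) (t s x : R).

Lemma cexpD z w : cexp (z + w) = cexp z * cexp w.
Proof.
case: z w => [a b] [c d]; rewrite /cexp; apply: complex_ext;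
  by rewrite !cpartsE expRD cosD sinD; ring.
Qed.

Lemma cexp0 : cexp 0 = 1 :> R[i].
Proof.
by rewrite /cexp (_ : Re 0 = 0) // (_ : Im 0 = 0) // expR0 cos0 sin0 mul1r.
Qed.

Lemma cexpNK z : cexp (- z) * cexp z = 1.
Proof. by rewrite -cexpD addNr cexp0. Qed.

Lemma Im_two_pi_i : Im (two_pi_i R) = 2 * pi. Proof. by []. Qed.

Lemma echarE t x :
  echar t x = Complex (cos (2 * pi * (t * x))) (sin (2 * pi * (t * x))).
Proof.
rewrite /echar /cexp; have -> : two_pi_i R * (t * x)%:C = Complex 0 (2 * pi * (t * x)).
  by apply: complex_ext; rewrite !cpartsE ?mul0r ?mulr0 ?subr0 ?add0r.
by apply: complex_ext; rewrite !cpartsE expR0; ring.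
Qed.

Lemma echarD t s x : echar (t + s) x = echar t x * echar s x.
Proof. by rewrite /echar mulrDl rmorphD mulrDr cexpD. Qed.

Lemma echar0 x : echar 0 x = 1 :> R[i].
Proof. by rewrite /echar mul0r mulr0 cexp0. Qed.

Lemma echarKN t x : echar t x * echar (- t) x = 1.
Proof. by rewrite -echarD subrr echar0. Qed.

Lemma echarJ t x : (echar t x)^* = echar (- t) x.
Proof.
rewrite !echarE mulNr mulrN cosN sinN; apply: complex_ext;
  by rewrite !cpartsE.
Qed.

Lemma sqmod_echar t x : sqmod (echar t x) = 1.
Proof. by have := sqmodE (echar t x); rewrite echarJ echarKN => /(congr1 Re). Qed.

Lemma two_pi_i_neq0 : two_pi_i R != 0.
Proof.
apply/eqP => /(congr1 Im); rewrite Im_two_pi_i => h.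
by have := pi_gt0 R; rewrite -(pmulr_rgt0 _ (ltr0n _ 2)) h ltxx.
Qed.

Lemma two_pi_iJ : (two_pi_i R)^* = - two_pi_i R.
Proof. by apply: complex_ext; rewrite !cpartsE ?oppr0. Qed.

Lemma echar_cexp t x : echar t x = cexp (two_pi_i R * t%:C * x%:C).
Proof. by rewrite /echar rmorphM /= mulrA. Qed.

Lemma cderiv_echar t : cderiv (echar t) (fun x => two_pi_i R * t%:C * echar t x).
Proof.
have := cderiv_cexp (two_pi_i R * t%:C).
rewrite (_ : echar t = fun x => cexp (two_pi_i R * t%:C * x%:C)) //.
by apply: funext => x; exact: echar_cexp.
Qed.

Lemma echar_inj t s : @echar R t = echar s -> t = s.
Proof.
move=> e; apply/eqP; rewrite -subr_eq0; apply/negPn/negP => d0.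
(* At this point [echar (t - s)] has the value [exp (pi i) = -1]. *)
have := congr1 (fun f => f (2 * (t - s))^-1) e => /= ee.
have : echar (t - s) (2 * (t - s))^-1 = 1 by rewrite echarD ee echarKN.
rewrite echarE (_ : 2 * pi * _ = pi); last by field.
move=> /(congr1 Re); rewrite cReI cospi => h.
have : (-1 : R) = 1 := h; lra.
Qed.

Lemma sqmod_sum_le (I : Type) (r : seq I) (F : I -> R[i]) :
  sqmod (\sum_(k <- r) F k) <= 2 ^+ size r * \sum_(k <- r) sqmod (F k).
Proof.
elim: r => [|k r IH]; first by rewrite !big_nil /sqmod /= expr0n addr0 mulr0.
rewrite !big_cons /=; apply: (le_trans (sqmodD_le _ _)).
have s0 : 0 <= \sum_(j <- r) sqmod (F j) by apply: sumr_ge0 => j _; exact: sqmod_ge0.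
have : 1 <= 2 ^+ size r :> R by rewrite exprn_ege1 // ler1n.
rewrite exprS; have := sqmod_ge0 (F k); move: IH s0.
have h (A B S P : R) : A <= P * S -> 0 <= S -> 0 <= B -> 1 <= P ->
  2 * B + 2 * A <= 2 * P * (B + S) by nra.
exact: h.
Qed.

End Exponentials.

(** * Linear algebra and endpoint vectors *)

Section LinearAlgebra.
Variables (F : fieldType) (n : nat).

Lemma unitmx_of_ker0 (M : 'M[F]_n) :
  (forall v : 'cV_n, M *m v = 0 -> v = 0) -> M \in unitmx.
Proof.
move=> h; rewrite -unitmx_tr -row_free_unit -kermx_eq0; apply/eqP/row_matrixP => i.
rewrite row0; apply: trmx_inj; rewrite trmx0; apply: h.
by apply: trmx_inj; rewrite trmx_mul trmxK trmx0 -row_mul mulmx_ker row0.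
Qed.

(** At an eigenvalue the boundary system [M v = - y] is singular; a [G] with [M G M = M] still
    recovers [v] from [M v] up to the kernel. *)
Lemma generalized_inverse (M : 'M[F]_n) :
  exists G : 'M[F]_n, forall v : 'cV_n, M *m (v - G *m (M *m v)) = 0.
Proof.
have e : M *m pinvmx M *m M = M := mulmxKpV (submx_refl M).
by exists (pinvmx M) => v; rewrite mulmxBr -{1}e -!mulmxA subrr.
Qed.

End LinearAlgebra.

Section HermitianDot.
Variables (R : realType) (n : nat).
Implicit Types (x y : 'cV[R[i]]_n) (B : 'M[R[i]]_n).

Definition hdot x y : R[i] := \sum_j x j 0 * (y j 0)^*.

Lemma hdotE x y : hdot x y = (map_mx Num.conj y^T *m x) 0 0.
Proof. by rewrite !mxE; apply: eq_bigr => j _; rewrite !mxE mulrC. Qed.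

Lemma hdot_unitary B x y : B \is unitarymx -> hdot (B *m x) (B *m y) = hdot x y.
Proof.
move=> /unitarymxP /mulmx1C BB; rewrite !hdotE trmx_mul map_mxM -mulmxA.
by rewrite (mulmxA (map_mx _ B^T)) BB mul1mx.
Qed.

End HermitianDot.

Section BoundaryValues.
Variables (R : realType) (n : nat) (alpha beta : 'cV[R]_n).
Local Notation V := ('I_n -> R -> (R[i])^o).

Definition endval (a : 'cV[R]_n) (u : V) : 'cV[R[i]]_n := \col_j u j (a j 0).

Lemma endvalE a u j : endval a u j 0 = u j (a j 0). Proof. by rewrite mxE. Qed.

Lemma endval_lin a (c : R[i]) u v : endval a (c *: u + v) = c *: endval a u + endval a v.
Proof. by apply/matrixP => j k; rewrite !mxE. Qed.

Lemma bdryE u v : bdry alpha beta u v =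
  hdot (endval beta u) (endval beta v) - hdot (endval alpha u) (endval alpha v).
Proof.
by rewrite /bdry /hdot -sumrB; apply: eq_bigr => j _; rewrite !endvalE.
Qed.

(** The general solution of [u' = 2 pi i mu u], with a separate amplitude on each interval. *)
Definition tmode (mu : R[i]) (v : 'cV[R[i]]_n) : V :=
  fun j x => v j 0 * cexp (two_pi_i R * mu * x%:C).

Lemma mul_Emx (w v : 'cV[R[i]]_n) : Emx w *m v = \col_j (cexp (w j 0) * v j 0).
Proof. by apply/matrixP => j k; rewrite /Emx mul_diag_mx !mxE (ord1 k). Qed.

Lemma endval_tmode a mu v : endval a (tmode mu v) =
  Emx ((two_pi_i R * mu) *: cvC a) *m v.
Proof.
by rewrite mul_Emx; apply/matrixP => j k; rewrite !mxE mulrC.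
Qed.

Lemma EmxNK (w : 'cV[R[i]]_n) : Emx (- w) *m Emx w = 1%:M.
Proof.
apply/matrixP => j k; rewrite /Emx mulmx_diag !mxE; case: eqP => [->|] //=.
by rewrite !mulr1n cexpNK.
Qed.

(** Multiply by the invertible [Emx] at [beta]. The kernels in [spectral_mx] thus consist of the
    amplitudes of eigenfunctions, and [const_mx 1] is the amplitude of the exponential itself. *)
Lemma ker_spectralP (B : 'M[R[i]]_n) mu v :
  ker_cV (1%:M - Emx (- (two_pi_i R * mu) *: cvC beta) *m B
     *m Emx ((two_pi_i R * mu) *: cvC alpha)) v <->
  B *m endval alpha (tmode mu v) = endval beta (tmode mu v).
Proof.
rewrite !endval_tmode /ker_cV /= mulmxBl mul1mx scaleNr -!mulmxA.
split=> [/eqP|->]; last by rewrite mulmxA EmxNK mul1mx subrr.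
rewrite subr_eq0 => /eqP e; rewrite [in RHS]e.
by rewrite [RHS]mulmxA (mulmx1C (EmxNK ((two_pi_i R * mu) *: cvC beta))) mul1mx.
Qed.

Lemma texpE t : @texp R n t = tmode t%:C (const_mx 1).
Proof.
by apply: funext => j; apply: funext => x; rewrite /texp /tmode mxE mul1r echar_cexp.
Qed.

Lemma tderiv_tmode mu v : tderiv (tmode mu v) ((two_pi_i R * mu) *: tmode mu v).
Proof.
move=> j; have := cderivZ (v j 0) (cderiv_cexp (two_pi_i R * mu)).
by apply: cderiv_eq => x; rewrite /tmode /= mulrCA.
Qed.

Lemma tcont_tmode mu v : tcont (tmode mu v).
Proof. exact: tderiv_cont (tderiv_tmode mu v). Qed.

Lemma tcont_texp t : tcont (@texp R n t).
Proof. by rewrite texpE; exact: tcont_tmode. Qed.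

Lemma tderiv_texp t : tderiv (@texp R n t) ((two_pi_i R * t%:C) *: texp t).
Proof. by rewrite texpE; exact: tderiv_tmode. Qed.

End BoundaryValues.

(** * The differential operator of a unitary matrix *)

Section Operator.
Variables (R : realType) (n : nat) (alpha beta : 'cV[R]_n).
Hypothesis alpha_lt_beta : forall i : 'I_n, alpha i 0 < beta i 0.
Variable B : 'M[R[i]]_n.
Local Notation V := ('I_n -> R -> (R[i])^o).
Local Notation tip := (tip alpha beta).
Local Notation sqn := (sqn tip).
Local Notation texp := (@texp R n).
Let TP := tip_prehilbert alpha_lt_beta.

(* [dop t u g] reads [(D - t) u = g], where [D = (2 pi i)^-1 d/dx] with the
   boundary condition [B u(alpha) = u(beta)]. *)
Definition dop (t : R) (u g : V) : Prop :=
  [/\ tderiv u (two_pi_i R *: (g + t%:C *: u)), tcont g &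
      B *m endval alpha u = endval beta u].

Lemma dop_cont t u g : dop t u g -> tcont u /\ tcont g.
Proof. by case=> d cg _; split=> //; exact: tderiv_cont d. Qed.

Lemma tderiv_lin (c : R[i]) (u du v dv : V) : tderiv u du -> tderiv v dv ->
  tderiv (c *: u + v) (c *: du + dv).
Proof. by move=> hu hv j; apply: cderivD; [apply: cderivZ; exact: hu|exact: hv]. Qed.

Lemma dop_lin t (c : R[i]) u g v h : dop t u g -> dop t v h ->
  dop t (c *: u + v) (c *: g + h).
Proof.
move=> [du cg bu] [dv ch bv]; split.
- move=> j; have := tderiv_lin c du dv j; apply: cderiv_eq => x.
  rewrite /= !fctE /GRing.scale /=; ring.
- by apply: (phD TP) => //; exact: (phZ TP).
- by rewrite !endval_lin mulmxDr -scalemxAr bu bv.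
Qed.

Lemma dop_shift t z u g : dop t u g -> dop (t + z) u (g - z%:C *: u).
Proof.
move=> h; have [cu cg] := dop_cont h; case: h => du _ bu; split => //.
- move=> j; have := du j; apply: cderiv_eq => x.
  by rewrite /= !fctE /GRing.scale /= rmorphD /=; ring.
- by apply: (phB TP) => //; exact: (phZ TP).
Qed.

Lemma dop_texp t l : B *m endval alpha (texp l) = endval beta (texp l) ->
  dop t (texp l) ((l - t)%:C *: texp l).
Proof.
move=> bl; split => //.
- move=> j; have := @tderiv_texp R n l j; apply: cderiv_eq => x.
  by rewrite /= !fctE /GRing.scale /= rmorphB /=; ring.
- by apply: (phZ TP); exact: tcont_texp.
Qed.

Lemma dop_sym t u g v h : B \is unitarymx -> dop t u g -> dop t v h ->
  tip g v = tip u h.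
Proof.
move=> uB hu hv; have [cu cg] := dop_cont hu; have [cv ch] := dop_cont hv.
case: hu hv => du _ bu [dv _ bv].
have := tip_by_parts alpha_lt_beta du dv.
rewrite bdryE -bu -bv hdot_unitary // subrr => H.
have Su : tcont (t%:C *: u) by exact: (phZ TP).
have Sv : tcont (t%:C *: v) by exact: (phZ TP).
have Sg : tcont (g + t%:C *: u) by exact: (phD TP).
have Sh : tcont (h + t%:C *: v) by exact: (phD TP).
have := H (phZ TP _ Sg) (phZ TP _ Sh).
rewrite (ipZl TP) // (ipZr TP) // two_pi_iJ mulNr -mulrBr.
move/eqP; rewrite mulf_eq0 (negbTE (two_pi_i_neq0 R)) /= subr_eq0 => /eqP.
rewrite (ipDl TP) // (ipDr TP) // (ipZl TP) // (ipZr TP) //.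
rewrite conjC_real.
exact: addIr.
Qed.

Let ker t := ker_cV (1%:M - Emx (- (two_pi_i R * t%:C) *: cvC beta) *m B
     *m Emx ((two_pi_i R * t%:C) *: cvC alpha)).

Lemma ker_texp t : ker t (const_mx 1) <->
  B *m endval alpha (texp t) = endval beta (texp t).
Proof. by rewrite /ker ker_spectralP texpE. Qed.

Hypothesis spB : spectral_mx alpha beta B.

(** The two alternatives of [spectral_mx] in one form, usable at eigenvalues and away from them
    alike. *)
Lemma ker_line t v : ker t v -> exists2 c : R[i], v = c *: const_mx 1 &
  B *m endval alpha (texp t) <> endval beta (texp t) -> c = 0.
Proof.
move=> kv; have [K0|K1] := spB t%:C; rewrite -/(ker t) in K0 || rewrite -/(ker t) in K1.
  by exists 0 => //; rewrite scale0r; move: kv; rewrite K0.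
move: kv; rewrite K1 => -[c _ <-]; exists c => //.
case; apply/ker_texp; rewrite K1; exists 1 => //; exact: scale1r.
Qed.

Lemma endval_duhamel (a : 'cV[R]_n) t (v : 'cV[R[i]]_n) (u : V) :
  (forall j, u j (a j 0) = echar t (a j 0) * v j 0) ->
  endval a u = Emx ((two_pi_i R * t%:C) *: cvC a) *m v.
Proof.
move=> h; rewrite mul_Emx; apply/matrixP => j k.
by rewrite !mxE h echar_cexp.
Qed.

(** For [u = e_t (v + Y)] with [Y(alpha) = 0] and [Y(beta) = y], the boundary condition is a linear
    system for the amplitude [v]. *)
Lemma bc_resolvent t (v y : 'cV[R[i]]_n) (u : V) :
  (forall j, u j (alpha j 0) = echar t (alpha j 0) * v j 0) ->
  (forall j, u j (beta j 0) = echar t (beta j 0) * (v + y) j 0) ->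
  B *m endval alpha u = endval beta u <->
  (1%:M - Emx (- (two_pi_i R * t%:C) *: cvC beta) *m B
     *m Emx ((two_pi_i R * t%:C) *: cvC alpha)) *m v = - y.
Proof.
move=> /endval_duhamel -> /endval_duhamel ->.
rewrite mulmxBl mul1mx scaleNr -!mulmxA; split=> [->|/eqP].
  by rewrite mulmxA EmxNK mul1mx opprD addNKr.
rewrite subr_eq addrC -subr_eq opprK => /eqP e; rewrite [in RHS]e.
by rewrite [RHS]mulmxA (mulmx1C (EmxNK ((two_pi_i R * t%:C) *: cvC beta))) mul1mx.
Qed.

Lemma cderiv_conjugated t (u g : V) j :
  tderiv u (two_pi_i R *: (g + t%:C *: u)) ->
  cderiv (fun x => echar (- t) x * u j x) (fun x => two_pi_i R * echar (- t) x * g j x).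
Proof.
move=> du; have := cderivM (cderiv_echar (- t)) (du j).
by apply: cderiv_eq => x; rewrite /= !fctE /GRing.scale /= rmorphN /=; ring.
Qed.

Lemma ler_term (F : 'I_n -> R) j : (forall k, 0 <= F k) -> F j <= \sum_k F k.
Proof. by move=> F0; rewrite (bigD1 j) //= lerDl sumr_ge0. Qed.

(* Writing [u = e_t (v + Y)] with [Y] an antiderivative of [2 pi i e_{-t} g], the
   boundary condition determines [v] from [Y(beta)] up to the kernel. *)
Lemma dop_estimate t : exists2 C : R, 0 <= C & forall u g, dop t u g ->
  (B *m endval alpha (texp t) = endval beta (texp t) -> tip u (texp t) = 0) ->
  sqn u <= C * sqn g.
Proof.
set M := 1%:M - Emx (- (two_pi_i R * t%:C) *: cvC beta) *m B
     *m Emx ((two_pi_i R * t%:C) *: cvC alpha).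
have [G hG] := generalized_inverse M.
pose L := \sum_j (beta j 0 - alpha j 0).
have Lj0 j : 0 <= beta j 0 - alpha j 0 by rewrite subr_ge0 ltW.
have L0 : 0 <= L by exact: sumr_ge0.
pose kappa := sqmod (two_pi_i R).
have k0 : 0 <= kappa by exact: sqmod_ge0.
pose s := size (index_enum 'I_n).
pose Ga := 2 ^+ s * \sum_j \sum_k sqmod (G j k).
have Ga0 : 0 <= Ga.
  rewrite mulr_ge0 ?exprn_ge0 //; apply: sumr_ge0 => j _; apply: sumr_ge0 => k _.
  exact: sqmod_ge0.
exists (L * ((2 + 2 * Ga) * (L * kappa))).
  by rewrite !mulr_ge0 // addr_ge0 // mulr_ge0.
move=> u g hu orth; have [cu cg] := dop_cont hu; case: (hu) => du _ bu.
pose b := L * (kappa * sqn g).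
have qg0 : 0 <= sqn g by exact: (sqn_ge0 TP).
have b0 : 0 <= b by rewrite !mulr_ge0.
pose F j x := echar (- t) x * u j x.
have cf j : ccont (fun x => two_pi_i R * echar (- t) x * g j x).
  apply: ccontM; last exact: cg.
  by apply: ccontM; [exact: ccont_cst|exact: cderiv_ccont (cderiv_echar _)].
have hY j x : alpha j 0 <= x <= beta j 0 -> sqmod (F j x - F j (alpha j 0)) <= b.
  move=> xj; apply: (le_trans (antiderivative_bound (cderiv_conjugated j du) (cf j) xj
    (alpha_lt_beta j))).
  rewrite (_ : (fun x => _ * _) = fun x => kappa%:C * (g j x * (g j x)^*)); last first.
    by apply: funext => z; rewrite [LHS]sqmodE 2!sqmodM sqmod_echar mulr1 rmorphM /= sqmodE.
  rewrite cintZ //; last by apply: ccontM; [exact: cg|apply: ccontJ; exact: cg].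
  rewrite cReM cImC mul0r subr0 cReC /b.
  apply: ler_pM => //; first by rewrite mulr_ge0 // Re_cint_ge0.
    exact: (@ler_term (fun j => beta j 0 - alpha j 0)).
  rewrite ler_wpM2l // sqn_sum.
  by apply: (@ler_term (fun j => Re (cint _ _ (fun x => g j x * (g j x)^*)))) => k;
    exact: Re_cint_ge0.
pose v : 'cV[R[i]]_n := \col_j F j (alpha j 0).
pose y : 'cV[R[i]]_n := \col_j (F j (beta j 0) - F j (alpha j 0)).
have FK j x : u j x = echar t x * F j x by rewrite /F mulrA echarKN mul1r.
have Mv : M *m v = - y.
  by apply/(bc_resolvent (u := u)) => // j; rewrite !mxE FK // addrC subrK.
have := hG v; rewrite Mv mulmxN opprK => /ker_line [c vc c0].
(* Either [u] is orthogonal to [texp t] or [c = 0]; in both cases subtracting the kernel component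
   cannot decrease [sqn]. *)
have qu : sqn u <= sqn (u - c *: texp t).
  have ce : tcont (c *: texp t) by apply: (phZ TP); exact: tcont_texp.
  rewrite (sqnB TP) //.
  have -> : tip u (c *: texp t) = 0.
    rewrite (ipZr TP) //; last exact: tcont_texp.
    have [e|ne] := pselect (B *m endval alpha (texp t) = endval beta (texp t)).
      by rewrite orth // mulr0.
    by rewrite c0 // rmorph0 mul0r.
  by rewrite mulr0 subr0 lerDl; exact: (sqn_ge0 TP).
apply: (le_trans qu); rewrite sqn_sum.
(* Since [v + G y = c 1], the difference is [e_t (Y - G y)], controlled by the increments in [hY]
   alone. *)
have pt j x : alpha j 0 <= x <= beta j 0 -> sqmod ((u - c *: texp t) j x) <= (2 + 2 * Ga) * b.
  move=> xj.
  have -> : (u - c *: texp t) j x = echar t x * ((F j x - F j (alpha j 0)) + - (G *m y) j 0).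
    have -> : (u - c *: texp t) j x = u j x - c * echar t x by [].
    have <- : F j (alpha j 0) + (G *m y) j 0 = c.
      have := congr1 (fun w : 'cV_n => w j 0) vc.
      by rewrite [LHS]mxE [v j 0]mxE [RHS]mxE [const_mx _ _ _]mxE mulr1.
    by rewrite FK; ring.
  rewrite sqmodM sqmod_echar mul1r; apply: (le_trans (sqmodD_le _ _)).
  rewrite [(2 + _) * b]mulrDl -[2 * Ga * b]mulrA.
  apply: lerD; rewrite ler_wpM2l //; first exact: hY.
  rewrite (_ : sqmod (- _) = sqmod ((G *m y) j 0)); last first.
    by rewrite /sqmod !cpartsE !sqrrN.
  rewrite mxE; apply: (le_trans (sqmod_sum_le _ _)).
  rewrite /Ga -mulrA ler_wpM2l ?exprn_ge0 //.
  apply: (@le_trans _ _ ((\sum_k sqmod (G j k)) * b)).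
    rewrite mulr_suml; apply: ler_sum => k _; rewrite sqmodM ler_wpM2l ?sqmod_ge0 //.
    by rewrite mxE hY // lexx (ltW (alpha_lt_beta k)).
  rewrite ler_wpM2r //.
  apply: (@ler_term (fun j => \sum_k sqmod (G j k))) => k; apply: sumr_ge0 => ? _.
  exact: sqmod_ge0.
have cuc : tcont (u - c *: texp t).
  by apply: (phB TP) => //; apply: (phZ TP); exact: tcont_texp.
apply: (@le_trans _ _ (\sum_j (beta j 0 - alpha j 0) * ((2 + 2 * Ga) * b))).
  by apply: ler_sum => j _; apply: Re_cint_sqmod_le => //; exact: pt.
rewrite -mulr_suml -/L (_ : L * ((2 + 2 * Ga) * b) = L * ((2 + 2 * Ga) * (L * kappa)) * sqn g) //.
by rewrite /b; ring.
Qed.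

(** Off the spectrum the boundary matrix is injective, so variation of constants closes with
    [v = - M^-1 y]. *)
Lemma dop_solve t g : B *m endval alpha (texp t) <> endval beta (texp t) ->
  tcont g -> exists u, dop t u g.
Proof.
move=> nt cg; set M := 1%:M - Emx (- (two_pi_i R * t%:C) *: cvC beta) *m B
     *m Emx ((two_pi_i R * t%:C) *: cvC alpha).
have uM : M \in unitmx.
  by apply: unitmx_of_ker0 => v /ker_line [c -> c0]; rewrite c0 // scale0r.
have cf j : ccont (fun x => two_pi_i R * echar (- t) x * g j x).
  apply: ccontM; last exact: cg.
  by apply: ccontM; [exact: ccont_cst|exact: cderiv_ccont (cderiv_echar _)].
have [F dF] := choice (fun j => cantiderivative (cf j)).
pose y : 'cV[R[i]]_n := \col_j (F j (beta j 0) - F j (alpha j 0)).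
pose v := invmx M *m - y.
pose u : V := fun j x => echar t x * (v j 0 + (F j x - F j (alpha j 0))).
exists u; split => //.
- move=> j; have dc := cderiv_cst (v j 0 - F j (alpha j 0)).
  have := cderivM (cderiv_echar t) (cderivD dc (dF j)).
  have -> : (fun x => echar t x * (v j 0 - F j (alpha j 0) + F j x)) = u j.
    by apply: funext => x; rewrite /u; congr (_ * _); ring.
  apply: cderiv_eq => x; rewrite /= !fctE /GRing.scale /= /u add0r.
  have e1 := echarKN t x.
  rewrite (_ : echar t x * (two_pi_i R * echar (- t) x * g j x) =
    two_pi_i R * ((echar t x * echar (- t) x) * g j x)); last by ring.
  by rewrite e1; ring.
- apply/(@bc_resolvent t v y) => [j|j|].
  + by rewrite /u subrr addr0.
  + by rewrite /u !mxE.
  + by rewrite /v mulKVmx.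
Qed.

End Operator.

(** * The spectrum of a spectral unitary matrix *)

(** The integer part of [(t - lo) / d] is injective on [X] and takes finitely many values there. *)
Lemma separated_finite (R : realType) (X : set R) (d lo hi : R) : 0 < d ->
  (forall t, X t -> lo <= t <= hi) ->
  (forall t s, X t -> X s -> t != s -> d <= `|t - s|) ->
  exists2 r : seq R, uniq r & forall t, t \in r <-> X t.
Proof.
move=> d0 Xb Xs.
pose K := (Num.truncn ((hi - lo) / d)).+1.
(* The value [K] off [X] makes [X] exactly the preimage of the numbers below [K]. *)
pose f t : nat := if `[< X t >] then Num.truncn ((t - lo) / d) else K.
have q0 t : X t -> 0 <= (t - lo) / d.
  by move=> /Xb /andP[h _]; rewrite divr_ge0 ?subr_ge0 // ltW.
have fX : f @^-1` `I_K = X.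
  apply/seteqP; split=> t; rewrite /= /f; case: asboolP => //; first by rewrite ltnn.
  move=> Xt _; rewrite ltnS; apply: le_truncn.
  by rewrite ler_pM2r ?invr_gt0 // lerD2r; have /andP[] := Xb _ Xt.
have : finite_set X.
  rewrite -fX; apply: finite_preimage; last exact: finite_II.
  move=> t s; rewrite fX !inE => Xt Xs'.
  rewrite /f !asboolT // => e; apply: contrapT => /eqP ne.
  have := Xs _ _ Xt Xs' ne; apply/negP; rewrite -ltNge.
  have := truncn_itv (q0 _ Xt); have := truncn_itv (q0 _ Xs'); rewrite e -natr1.
  move: (_%:R) => k /andP[h1 h2] /andP[h3 h4].
  have : `|(t - lo) / d - (s - lo) / d| < 1 by rewrite ltr_norml; apply/andP; split; lra.
  by rewrite -mulrBl normrM (gtr0_norm (_ : 0 < d^-1)) ?invr_gt0 //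
    ltr_pdivrMr // mul1r opprB addrA subrK.
move=> /finite_seqP[r Xr]; exists (undup r); first exact: undup_uniq.
by move=> t; rewrite mem_undup Xr.
Qed.

Section Spectrum.
Variables (R : realType) (n : nat) (alpha beta : 'cV[R]_n).
Hypothesis n_gt0 : (0 < n)%N.
Hypothesis alpha_lt_beta : forall i : 'I_n, alpha i 0 < beta i 0.
Hypothesis beta_lt_alpha : forall i j : 'I_n, j = i.+1 :> nat ->
  beta i 0 < alpha j 0.
Local Notation mu := (@lebesgue_measure R).
Local Notation Omega := (interval_union alpha beta).
Local Notation V := ('I_n -> R -> (R[i])^o).
Local Notation tip := (tip alpha beta).
Local Notation sqn := (sqn tip).
Local Notation texp := (@texp R n).
Let TP := tip_prehilbert alpha_lt_beta.

Lemma tip_texp t : tip (texp t) (texp t) = (fine (mu Omega))%:C.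
Proof.
rewrite (lebesgue_interval_union alpha_lt_beta beta_lt_alpha) rmorph_sum.
apply: eq_bigr => j _ /=.
rewrite (_ : (fun x => _) = fun x => (1 : R[i])); last first.
  by apply: funext => x; rewrite sqmodE sqmod_echar.
rewrite (@cint_FTC _ (fun x => x%:C)) //; first by rewrite rmorphB.
  exact: ccont_cst.
by move=> x; split; [exact: is_derive_ident|exact: is_derive_const].
Qed.

Lemma hdot_texp (a : 'cV[R]_n) t s :
  hdot (endval a (texp t)) (endval a (texp s)) = \sum_j echar (t - s) (a j 0).
Proof.
by apply: eq_bigr => j _; rewrite !endvalE /texp echarJ echarD.
Qed.

Lemma L2inner_normalized t s :
  L2inner Omega (normalized_echar Omega t) (normalized_echar Omega s) =
  ((fine (mu Omega))^-1)%:C * tip (texp t) (texp s).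
Proof.
set m := fine _; have m0 : 0 < m by exact: measure_interval_union_gt0.
pose c : R[i] := ((Num.sqrt m)^-1)%:C.
have ag l : agree alpha beta (normalized_echar Omega l) (c *: texp l) by [].
have ct := @tcont_texp R n t; have cs := @tcont_texp R n s.
have ce l : tcont (c *: texp l) by apply: (phZ TP); exact: tcont_texp.
rewrite (L2inner_agree alpha_lt_beta beta_lt_alpha (ag t) (ag s)) //.
rewrite (ipZl TP) ?(ipZr TP) // mulrA sqmodE /sqmod /c cReC cImC.
by rewrite expr0n addr0 exprVn sqr_sqrtr // ltW.
Qed.

(** With [hdot_texp], the link between orthogonality on the set and isometry of endpoint vectors:
    [spectrum_orth] reads it in one direction, [basis_hdot] in the other. *)
Lemma tip_texp_by_parts t s : two_pi_i R * (t - s)%:C * tip (texp t) (texp s) =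
  \sum_j echar (t - s) (beta j 0) - \sum_j echar (t - s) (alpha j 0).
Proof.
have := tip_by_parts alpha_lt_beta (@tderiv_texp R n t) (@tderiv_texp R n s)
  (phZ TP _ (@tcont_texp R n t)) (phZ TP _ (@tcont_texp R n s)).
rewrite bdryE !hdot_texp => <-.
have ct := @tcont_texp R n t; have cs := @tcont_texp R n s.
rewrite (ipZl TP) // (ipZr TP) // rmorphM /= two_pi_iJ.
rewrite conjC_real.
by rewrite rmorphB /=; ring.
Qed.

(* For small [r] the imaginary parts differ, the sine being increasing on
   [[- pi / 2, pi / 2]]. *)
Lemma echar_sums_differ : exists2 d : R, 0 < d & forall r, 0 < r -> r < d ->
  \sum_j echar r (beta j 0) <> \sum_j echar r (alpha j 0) :> R[i].
Proof.
pose M : R := 1 + \sum_j (`|alpha j 0| + `|beta j 0|).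
have S0 : 0 <= \sum_j (`|alpha j 0| + `|beta j 0|).
  by apply: sumr_ge0 => j _; rewrite addr_ge0.
have M0 : 0 < M by rewrite /M; lra.
have Mj j : `|alpha j 0| <= M /\ `|beta j 0| <= M.
  have := @ler_term R n (fun j => `|alpha j 0| + `|beta j 0|) j
    (fun j => addr_ge0 (normr_ge0 _) (normr_ge0 _)).
  have := normr_ge0 (alpha j 0); have := normr_ge0 (beta j 0).
  by rewrite /M => ? ? /= ?; split; lra.
have p0 := pi_gt0 R.
exists (4 * M)^-1; first by rewrite invr_gt0 mulr_gt0.
move=> r r0 rd e.
have small (x : R) : `|x| <= M -> 2 * pi * (r * x) \in `[- (pi / 2), pi / 2].
  move=> xM; have : `|r * x| <= 4^-1.
    rewrite normrM (gtr0_norm r0); apply: (@le_trans _ _ ((4 * M)^-1 * M)).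
      by rewrite ler_pM // ltW.
    by rewrite invfM -mulrA mulVf ?gt_eqF // mulr1.
  rewrite ler_norml => /andP[h1 h2]; rewrite in_itv /=.
  by apply/andP; split; nra.
have := congr1 Im e; rewrite !cIm_sum; apply/eqP; rewrite gt_eqF //.
pose j0 : 'I_n := Ordinal n_gt0.
have lt j : Im (echar r (alpha j 0)) < Im (echar r (beta j 0)).
  have [h1 h2] := Mj j.
  rewrite !echarE /= ltr_sin ?small // ltr_pM2l ?mulr_gt0 //.
  by rewrite ltr_pM2l.
rewrite (bigD1 j0) // [ltRHS](bigD1 j0) //; apply: ltr_leD => //.
by apply: ler_sum => j _; exact: ltW.
Qed.

Section UnitaryMatrix.
Variable B : 'M[R[i]]_n.
Hypotheses (uB : B \is unitarymx) (spB : spectral_mx alpha beta B).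

Definition spectrum : set R :=
  [set t | B *m endval alpha (texp t) = endval beta (texp t)].

Lemma spectrum_orth t s : spectrum t -> spectrum s -> t != s ->
  tip (texp t) (texp s) = 0.
Proof.
move=> ht hs ts; have := tip_texp_by_parts t s.
rewrite -!hdot_texp -ht -hs hdot_unitary // subrr => /eqP.
rewrite !mulf_eq0 (negbTE (two_pi_i_neq0 R)) /=.
rewrite (_ : ((t - s)%:C == 0) = false) /=; last first.
  by rewrite (inj_eq (@complexI R)) subr_eq0 (negbTE ts).
by move/eqP.
Qed.

(** For two spectral points unitarity equates the endpoint sums of [echar (t - s)], which
    [echar_sums_differ] excludes at small distance. *)
Lemma spectrum_separated : exists2 d : R, 0 < d &
  forall t s, spectrum t -> spectrum s -> t != s -> d <= `|t - s|.
Proof.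
have [d d0 hd] := echar_sums_differ; exists d => // t s ht hs ts.
have hlt a b : spectrum a -> spectrum b -> b < a -> d <= a - b.
  move=> ha hb ab; rewrite leNgt; apply/negP => /(hd (a - b)).
  rewrite subr_gt0 => /(_ ab); rewrite -!hdot_texp -ha -hb hdot_unitary //.
case: (ltgtP t s) ts => // [ts|st] _.
  by rewrite distrC gtr0_norm ?subr_gt0 // hlt.
by rewrite gtr0_norm ?subr_gt0 // hlt.
Qed.

(** Provides a base point [t0] at which [dop_solve] applies. *)
Lemma spectrum_proper : exists t0, ~ spectrum t0.
Proof.
have [d d0 hd] := spectrum_separated.
have [h0|] := pselect (spectrum 0); last by exists 0.
exists (d / 2) => h1; have d2 : 0 < d / 2 by rewrite divr_gt0.
have := hd _ _ h1 h0 (lt0r_neq0 d2); rewrite subr0 gtr0_norm //.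
lra.
Qed.

Let m := fine (mu Omega).
Let m0 : 0 < m.
Proof. exact: measure_interval_union_gt0. Qed.
Let Se t : tcont (texp t) := @tcont_texp R n t.
Local Notation P := (ph_proj tip texp m).

(** [D - t0] commutes with the projection, so it sends the residual of [w] to the residual of
    [g = (D - t0) w], whose squared norm is at most [sqn g] by Bessel. Hence [C = sqn g] serves for
    all [N]. *)
Lemma spectrum_approx w dw : tderiv w dw -> tcont dw ->
  tvanish alpha beta w -> exists C : R, forall N : R, 0 < N ->
    exists2 s : seq R, (forall t, t \in s -> spectrum t) &
      N ^+ 2 * sqn (w - P s w) <= C.
Proof.
move=> dW cdw vw; have [t0 ht0] := spectrum_proper.
pose g : V := (two_pi_i R)^-1 *: dw - t0%:C *: w.
have cw := tderiv_cont dW.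
have cg : tcont g by apply: (phB TP); exact: (phZ TP).
have dopw : dop alpha beta B t0 w g.
  split => //.
    move=> j; have := dW j; apply: cderiv_eq => x.
    rewrite /g /= !fctE /GRing.scale /= subrK mulrA divff ?two_pi_i_neq0 //.
    by rewrite mul1r.
  apply/matrixP => j k; rewrite !mxE (vw j).2 big1 // => i _.
  by rewrite mxE (vw i).1 mulr0.
exists (sqn g) => N N0.
have [d d0 hd] := spectrum_separated.
have [s us hs] : exists2 r : seq R, uniq r &
    forall t, t \in r <-> [set t | spectrum t /\ t0 - N <= t <= t0 + N] t.
  apply: (@separated_finite _ _ d (t0 - N) (t0 + N)) => //; first by move=> t [].
  by move=> t t' [ht _] [ht' _]; exact: hd.
exists s; first by move=> t /hs [].
pose K : set V := [set u | tcont u /\ forall t, t \in s -> tip u (texp t) = 0].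
have orth : {in s &, forall i j, i != j -> tip (texp i) (texp j) = 0}.
  by move=> i j /hs [hi _] /hs [hj _]; exact: spectrum_orth.
have dope t : t \in s -> dop alpha beta B t0 (texp t) ((t - t0)%:C *: texp t).
  by move=> /hs [ht _]; exact: dop_texp.
have nt0 t : t \in s -> (t - t0)%:C != 0 :> R[i].
  move=> /hs [ht _]; rewrite (inj_eq (@complexI R)) subr_eq0.
  by apply/eqP => e; apply: ht0; rewrite -e.
(* The operator acts diagonally on coefficients. This yields the commutation with the projection
   and, as [t != t0], that solutions of the equation stay in [K]. *)
have dop_coef u h t : dop alpha beta B t0 u h -> t \in s ->
    tip h (texp t) = (t - t0)%:C * tip u (texp t).
  move=> du st; have [cu ch] := dop_cont du.
  by rewrite (dop_sym alpha_lt_beta uB du (dope t st)) (ipZr TP) // conjC_real.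
have dopP r : {subset r <= s} -> dop alpha beta B t0 (P r w) (P r g).
  elim: r => [|t r IH] rs.
    rewrite /ph_proj !big_nil; split=> //.
    - move=> j; rewrite scaler0 addr0 scaler0; exact: cderiv_cst.
    - exact: (ph0 TP).
    - by apply/matrixP => j k; rewrite !mxE big1 // => i _; rewrite mxE mulr0.
  rewrite /ph_proj !big_cons; have st : t \in s by apply: rs; rewrite mem_head.
  have rs' : {subset r <= s} by move=> x xr; apply: rs; rewrite inE xr orbT.
  have := dop_lin alpha_lt_beta (tip w (texp t) / m%:C) (dope t st) (IH rs').
  rewrite scalerA; congr (dop _ _ _ _ _ (_ *: _ + _)).
  by rewrite (dop_coef _ _ _ dopw st); ring.
have dopr : dop alpha beta B t0 (w - P s w) (g - P s g).
  have := dop_lin alpha_lt_beta (-1) (dopP s (fun x h => h)) dopw.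
  by rewrite !scaleN1r ![- _ + _]addrC.
have [cr _] := dop_cont dopr.
have Kr : K (w - P s w).
  by split=> // t st; apply: (ip_proj_orth TP m0 Se tip_texp us orth).
apply: (le_trans _ (ph_proj_bessel TP m0 Se tip_texp us orth cg)).
apply: (symmetric_lower_bound TP (G := dop alpha beta B t0) (K := K)) => //.
- by move=> u h; exact: dop_cont.
- by move=> c u h v k; exact: dop_lin.
- by move=> u h v k; exact: dop_sym.
- move=> c u v [cu Ku] [cv Kv]; split; first by apply: (phD TP) => //; exact: (phZ TP).
  move=> t st; have ct := Se t.
  by rewrite (ipDl TP) ?(ipZl TP) // ?Ku ?Kv ?mulr0 ?addr0 //; exact: (phZ TP).
- move=> h ch [_ Kh]; have [u du] := dop_solve spB ht0 ch.
  exists u => //; have [cu _] := dop_cont du; split=> // t st.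
  have := dop_coef _ _ _ du st; rewrite Kh // => /esym/eqP.
  by rewrite mulf_eq0 (negbTE (nt0 t st)) /= => /eqP.
(* If [t0 + z] is in the spectrum, [|z| < N] puts it into [s], so [u] in [K] has the orthogonality
   that [dop_estimate] asks for. *)
- move=> z zN; have [C C0 hC] := dop_estimate alpha_lt_beta spB (t0 + z).
  exists C => // u h du [cu Ku]; apply: hC.
    exact: dop_shift.
  move=> hz; apply: Ku; apply/hs; split=> //.
  by move: zN; rewrite ltr_norml => /andP[? ?]; apply/andP; split; lra.
Qed.

Lemma spectrum_total : L2total Omega [set normalized_echar Omega l | l in spectrum].
Proof.
apply: L2total_criterion => // w dw dW cdw vw eps eps0.
have [C hC] := spectrum_approx dW cdw vw.
(* Then [N ^+ 2 * eps >= N * eps = eps + |C| > C]. *)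
pose N : R := 1 + `|C| / eps.
have N1 : 1 <= N by rewrite /N lerDl divr_ge0 // ltW.
have N0 : 0 < N by lra.
have [s hs le] := hC N N0.
exists (size s), (fun k => tip w (texp (tnth (in_tuple s) k)) / m%:C),
  (fun k => tnth (in_tuple s) k); split.
  by move=> k; apply: hs; exact: mem_tnth.
have eP : P s w = \sum_k (tip w (texp (tnth (in_tuple s) k)) / m%:C) *:
    texp (tnth (in_tuple s) k) by rewrite /ph_proj big_tnth.
rewrite -eP.
have q0 : 0 <= sqn (w - P s w).
  apply: (sqn_ge0 TP); apply: (phB TP); first exact: tderiv_cont dW.
  exact: ph_proj_in.
have : N * eps <= N ^+ 2 * eps by rewrite ler_pM2r // expr2 ler_peMr // ltW.
have : N * eps = eps + `|C| by rewrite /N mulrDl mul1r divfK // gt_eqF.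
have := ler_norm C => h1 h2 h3.
rewrite ltNge; apply/negP => h4.
have : N ^+ 2 * eps <= N ^+ 2 * sqn (w - P s w) by rewrite ler_wpM2l // sqr_ge0.
lra.
Qed.

Lemma spectrum_orthonormal_basis :
  L2orthonormal_basis Omega [set normalized_echar Omega l | l in spectrum].
Proof.
split; last exact: spectrum_total.
split.
- move=> _ [l _ <-]; pose c : R[i] := ((Num.sqrt m)^-1)%:C.
  have ag : agree alpha beta (normalized_echar Omega l) (c *: texp l) by [].
  by apply: inL2_agree ag (phZ TP c (Se l)).
- move=> _ [l _ <-]; rewrite L2inner_normalized tip_texp -rmorphM /=.
  by rewrite mulVf // gt_eqF.
- move=> _ _ [l hl <-] [k hk <-] ne; rewrite L2inner_normalized spectrum_orth ?mulr0 //.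
  by apply/eqP => e; apply: ne; rewrite e.
Qed.

End UnitaryMatrix.
End Spectrum.

(** * The unitary matrix of a spectrum *)

(** Rows are added one at a time. If every [a t] lay in the row space of [A], all would annihilate
    the columns of [cokermx A]; these would vanish and [A] would already have rank [n]. *)
Lemma unitmx_of_span (F : fieldType) (n : nat) (T : Type) (X : T -> Prop)
    (a : T -> 'rV[F]_n) :
  (forall w : 'cV_n, (forall t, X t -> a t *m w = 0) -> w = 0) ->
  exists2 l : 'I_n -> T, (forall i, X (l i)) & (\matrix_i a (l i)) \in unitmx.
Proof.
move=> span.
suff H k : (k <= n)%N -> exists2 l : 'I_k -> T, (forall i, X (l i)) &
    \rank (\matrix_i a (l i)) = k.
  have [l Xl rl] := H n (leqnn n); exists l => //.
  by rewrite -row_free_unit /row_free rl.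
elim: k => [_|k IH kn].
  exists (fun i : 'I_0 => False_rect T (notF (ltn_ord i))) => [[]//|].
  by apply/eqP; rewrite -leqn0 rank_leq_row.
have [l Xl rl] := IH (ltnW kn); set A := \matrix_i a (l i) in rl.
have [t Xt ta] : exists2 t, X t & ~~ (a t <= A)%MS.
  apply: contrapT => h.
  have cj j : col j (cokermx A) = 0.
    apply: span => t Xt.
    have : (a t <= A)%MS by apply/negPn/negP => ta; apply: h; exists t.
    by rewrite submxE => /eqP e; rewrite colE mulmxA e mul0mx.
  have c0 : cokermx A = 0.
    by apply/matrixP => i j; have /matrixP /(_ i 0) := cj j; rewrite mxE => ->; rewrite !mxE.
  have := mxrank_coker A; rewrite c0 mxrank0 rl => /eqP.
  by rewrite eq_sym subn_eq0 leqNgt kn.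
exists (fun i : 'I_(1 + k) => oapp l t (unlift ord0 i)).
  by move=> i; case: (unlift ord0 i) => [j|] /=.
set A' := \matrix_i _.
have eA : A' = col_mx (a t) A.
  apply/matrixP => i j; rewrite !mxE; case: splitP => i' ei.
    have -> : i = ord0 by apply: val_inj; rewrite /= ei (ord1 i').
    by rewrite unlift_none /= (ord1 i').
  have -> : i = lift ord0 i' by apply: val_inj; rewrite /= ei.
  by rewrite liftK /= mxE.
apply/eqP; rewrite eqn_leq rank_leq_row /= -{1}rl; apply: rank_ltmx.
rewrite ltmxE eA; apply/andP; split.
  by have := addsmxSr (a t) A; rewrite addsmxE.
by apply: contra ta => h; apply: submx_trans h; have := addsmxSl (a t) A; rewrite addsmxE.
Qed.

Section Forward.
Variables (R : realType) (n : nat) (alpha beta : 'cV[R]_n).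
Hypothesis n_gt0 : (0 < n)%N.
Hypothesis alpha_lt_beta : forall i : 'I_n, alpha i 0 < beta i 0.
Hypothesis beta_lt_alpha : forall i j : 'I_n, j = i.+1 :> nat ->
  beta i 0 < alpha j 0.
Local Notation mu := (@lebesgue_measure R).
Local Notation Omega := (interval_union alpha beta).
Local Notation V := ('I_n -> R -> (R[i])^o).
Local Notation tip := (tip alpha beta).
Local Notation sqn := (sqn tip).
Local Notation texp := (@texp R n).
Let TP := tip_prehilbert alpha_lt_beta.
Variable Lambda : set R.
Hypothesis basis : L2orthonormal_basis Omega
  [set normalized_echar Omega l | l in Lambda].

Let m := fine (mu Omega).
Let m0 : 0 < m.
Proof. exact: measure_interval_union_gt0. Qed.
Let Se t : tcont (texp t) := @tcont_texp R n t.
Let S := Num.sqrt m.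
Let S_gt0 : 0 < S. Proof. by rewrite sqrtr_gt0. Qed.
Let tipt := tip_texp alpha_lt_beta beta_lt_alpha.

Lemma basis_orth t s : Lambda t -> Lambda s -> t != s -> tip (texp t) (texp s) = 0.
Proof.
move=> ht hs ts; have [[_ _ orth] _] := basis.
have := orth (normalized_echar Omega t) (normalized_echar Omega s)
  (ex_intro2 _ _ _ ht erefl) (ex_intro2 _ _ _ hs erefl).
have ne : normalized_echar Omega t <> normalized_echar Omega s.
  move=> e; move/eqP: ts; apply; apply: echar_inj; apply: funext => x.
  have := congr1 (fun f => f x) e; rewrite /normalized_echar; apply: mulfI.
  by rewrite (inj_eq (@complexI R)) invr_eq0 gt_eqF.
move=> /(_ ne); rewrite L2inner_normalized // => /eqP.
rewrite mulf_eq0 (inj_eq (@complexI R)) invr_eq0 gt_eqF //=.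
by move/eqP.
Qed.

Lemma basis_hdot t s : Lambda t -> Lambda s ->
  hdot (endval beta (texp t)) (endval beta (texp s)) =
  hdot (endval alpha (texp t)) (endval alpha (texp s)).
Proof.
move=> ht hs; rewrite !hdot_texp; have [->|ts] := eqVneq t s.
  by apply: eq_bigr => j _; rewrite subrr !echar0.
apply/eqP; rewrite -subr_eq0 -tip_texp_by_parts //.
by rewrite basis_orth // mulr0.
Qed.

Definition glue (u : V) (x : R) : R[i] :=
  \sum_j (if alpha j 0 < x < beta j 0 then u j x else 0).

Lemma glue_agree u : agree alpha beta (glue u) u.
Proof.
move=> j x xj; rewrite /glue (bigD1 j) //= xj big1 ?addr0 // => i ij.
case: ifP => // /andP[h1 h2]; move/andP: xj => [h3 h4].
case: (ltngtP i j) ij => [lij|lji|/val_inj ->]; last by rewrite eqxx.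
  by have h5 := beta_le_alpha alpha_lt_beta beta_lt_alpha lij; exfalso; lra.
by have h5 := beta_le_alpha alpha_lt_beta beta_lt_alpha lji; exfalso; lra.
Qed.

(** Totality gives some close combination with unknown coefficients. Projecting on its frequencies
    does at least as well and has explicit coefficients, which [basis_span] exploits. *)
Lemma basis_proj u eps : tcont u -> 0 < eps -> exists s : seq R,
  [/\ uniq s, forall t, t \in s -> Lambda t & sqn (u - ph_proj tip texp m s u) < eps].
Proof.
move=> cu eps0; have [_ total] := basis.
have e0 : 0 < Num.sqrt eps by rewrite sqrtr_gt0.
have [k [g [c [hg hc]]]] := total _ (inL2_agree alpha_lt_beta beta_lt_alpha (glue_agree u) cu) _ e0.
have [l hl] := choice (fun i => let: ex_intro2 t ht et := hg i in
  ex_intro (fun t => Lambda t /\ normalized_echar Omega t = g i) t (conj ht et)).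
pose s := undup [seq l i | i : 'I_k].
have ls i : l i \in s by rewrite mem_undup map_f // mem_enum.
have sL t : t \in s -> Lambda t by rewrite mem_undup => /mapP[i _ ->]; exact: (hl i).1.
exists s; split => //; first exact: undup_uniq.
have orth : {in s &, forall i j, i != j -> tip (texp i) (texp j) = 0}.
  by move=> i j /sL hi /sL hj; exact: basis_orth.
pose c' i := c i * (S^-1)%:C.
apply: (le_lt_trans (ph_proj_best TP m0 Se tipt (undup_uniq _) orth c' cu ls)).
have cp : tcont (u - \sum_i c' i *: texp (l i)).
  by apply: (phB TP) => //; apply: (ph_sum TP) => i; apply: (phZ TP); exact: Se.
have ag : agree alpha beta (fun x => glue u x - \sum_i c i * g i x)
    (u - \sum_i c' i *: texp (l i)).
  move=> j x xj; rewrite (glue_agree u xj).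
  have -> : (u - \sum_i c' i *: texp (l i)) j x = u j x - (\sum_i c' i *: texp (l i)) j x by [].
  rewrite tuple_sumE; congr (_ - _); apply: eq_bigr => i _.
  by rewrite -(hl i).2 /normalized_echar mulrA.
move: hc; rewrite (L2norm_agree alpha_lt_beta beta_lt_alpha ag cp) lte_fin.
by rewrite ltr_sqrt.
Qed.

Lemma basis_complete u : tcont u -> (forall t, Lambda t -> tip u (texp t) = 0) ->
  sqn u = 0.
Proof.
move=> cu u0; apply/eqP; rewrite eq_le (sqn_ge0 TP cu) andbT leNgt; apply/negP => h.
have [s [us sL]] := basis_proj cu h.
have -> : ph_proj tip texp m s u = 0.
  by rewrite /ph_proj big_seq big1 // => t /sL /u0 ->; rewrite mul0r scale0r.
by rewrite subr0 ltxx.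
Qed.

(* For the function [u] interpolating linearly between [u(alpha) = w] and
   [u(beta) = 0], the expansion of [u] in the basis makes [<u', u>] purely
   imaginary, whereas [2 Re <u', u> = - |w| ^+ 2]. *)
Lemma basis_span (w : 'cV[R[i]]_n) :
  (forall t, Lambda t -> hdot w (endval alpha (texp t)) = 0) -> w = 0.
Proof.
move=> w0.
pose L j := beta j 0 - alpha j 0; have L0 j : 0 < L j by rewrite subr_gt0.
pose u : V := fun j x => w j 0 * ((L j)^-1 * (beta j 0 - x))%:C.
pose du : V := fun j x => w j 0 * (- (L j)^-1)%:C.
have d1 : tderiv u du.
  move=> j; apply: cderivZ => x; split; last exact: is_derive_const.
  by apply: is_derive_eq; rewrite /GRing.scale /=; ring.
have cdu : tcont du by move=> j; exact: ccont_cst.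
have cu := tderiv_cont d1.
have ub : endval beta u = 0.
  by apply/matrixP => j k; rewrite !mxE /u subrr mulr0 mulr0.
have ua : endval alpha u = w.
  apply/matrixP => j k; rewrite mxE /u (ord1 k) -[beta j 0 - _]/(L j).
  by rewrite mulVf ?gt_eqF // mulr1.
have h0 (y : 'cV[R[i]]_n) : hdot 0 y = 0 by apply: big1 => j _; rewrite mxE mul0r.
have coef t : Lambda t -> tip du (texp t) = two_pi_i R * t%:C * tip u (texp t).
  move=> ht; have ct := Se t.
  have := tip_by_parts alpha_lt_beta d1 (@tderiv_texp R n t) cdu (phZ TP _ ct).
  rewrite bdryE ub ua h0 w0 // subrr (ipZr TP) // rmorphM /= two_pi_iJ.
  rewrite conjC_real.
  by move/eqP; rewrite addr_eq0 => /eqP ->; ring.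
have Rew : 2 * Re (tip du u) = - \sum_j sqmod (w j 0).
  have := congr1 Re (tip_by_parts alpha_lt_beta d1 d1 cdu cdu).
  rewrite bdryE ub ua h0 sub0r cReD (ipC TP cdu cu) cReJ cReN => e.
  have -> : \sum_j sqmod (w j 0) = Re (hdot w w).
    by rewrite /hdot cRe_sum; apply: eq_bigr => j _; rewrite sqmodE.
  by rewrite -e; ring.
have W0 : 0 <= \sum_j sqmod (w j 0) by apply: sumr_ge0 => j _; exact: sqmod_ge0.
have qd : 0 <= sqn du by exact: (sqn_ge0 TP).
(* A finite projection [p] stands in for the infinite expansion: [Re (tip du p) = 0] holds term by
   term, because [coef] makes each term an imaginary multiple of [|<u, e_t>|^2]. Only
   [tip du (u - p)] remains. *)
have bound e : 0 < e -> \sum_j sqmod (w j 0) <= e * (sqn du + 1).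
  move=> e0; have e2 : 0 < e ^+ 2 by rewrite exprn_gt0.
  have [s [us sL hs]] := basis_proj cu e2.
  set p := ph_proj tip texp m s u in hs.
  have cp : tcont p by exact: (ph_proj_in TP).
  have cup : tcont (u - p) by exact: (phB TP).
  have Rp : Re (tip du p) = 0.
    rewrite /p /ph_proj (ip_sumr TP) //; last by move=> t; apply: (phZ TP).
    rewrite cRe_sum big_seq big1 // => t /sL ht.
    rewrite (ipZr TP) // coef // rmorphM /= fmorphV /=.
    rewrite conjC_real.
    set z := tip u (texp t).
    rewrite (_ : z^* / m%:C * (two_pi_i R * t%:C * z) =
      two_pi_i R * (t%:C * (z * z^*) * (m%:C)^-1)); last by ring.
    rewrite sqmodE -rmorphM -fmorphV -rmorphM /=.
    by rewrite mul0r mulr0 subrr.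
  have := ip_young TP e0 cdu cup; rewrite (ipBr TP) // cReD cReN Rp subr0 Rew normrN ger0_norm //.
  move=> h; apply: (le_trans h); rewrite mulrDr lerD2l mulr1.
  by rewrite mulrC ler_pdivrMr // -expr2 ltW.
have W : \sum_j sqmod (w j 0) = 0.
  apply/eqP; rewrite eq_le W0 andbT leNgt; apply/negP => h.
  pose e := (\sum_j sqmod (w j 0)) / (2 * (sqn du + 1)).
  have q1 : 0 < sqn du + 1 by lra.
  have e0 : 0 < e by rewrite divr_gt0 // mulr_gt0.
  have := bound e e0; rewrite (_ : e * _ = (\sum_j sqmod (w j 0)) / 2); first by lra.
  by rewrite /e; field; rewrite gt_eqF.
apply/matrixP => j k; rewrite (ord1 k) mxE; apply: sqmod_eq0.
by apply: (psumr_eq0P (fun j _ => sqmod_ge0 (w j 0)) W).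
Qed.

Let c : R[i] := ((Num.sqrt n%:R)^-1)%:C.
Let c0 : c != 0.
Proof. by rewrite (inj_eq (@complexI R)) invr_eq0 gt_eqF // sqrtr_gt0 ltr0n. Qed.

Lemma MexpE (a lambda : 'cV[R]_n) i j :
  Mexp a lambda i j = c * endval a (texp (lambda j 0)) i 0.
Proof. by rewrite !mxE /texp /echar [_ * lambda j 0]mulrC. Qed.

Lemma basis_points : exists2 lambda : 'cV[R]_n, (forall j, Lambda (lambda j 0)) &
  Mexp alpha lambda \in unitmx.
Proof.
have [|l hl ul] := @unitmx_of_span R[i] n R Lambda (fun t => (endval alpha (texp t))^T).
  move=> w hw.
  (* The pairing in [unitmx_of_span] is bilinear and [hdot] is sesquilinear, whence the
     conjugate. *)
  have : map_mx Num.conj w = 0.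
    apply: basis_span => t /hw /matrixP /(_ 0 0); rewrite !mxE => h.
    have -> : hdot (map_mx Num.conj w) (endval alpha (texp t)) =
        (\sum_j (endval alpha (texp t))^T 0 j * w j 0)^*.
      by rewrite /hdot rmorph_sum; apply: eq_bigr => j _; rewrite rmorphM mulrC !mxE.
    by rewrite h rmorph0.
  move=> /matrixP h; apply/matrixP => j k.
  by have := h j k; rewrite !mxE => /eqP; rewrite conjC_eq0 => /eqP.
exists (\col_j l j); first by move=> j; rewrite mxE.
rewrite (_ : Mexp _ _ = c *: (\matrix_i (endval alpha (texp (l i)))^T)^T).
  by rewrite unitmxZ ?unitfE // unitmx_tr.
by apply/matrixP => i j; rewrite MexpE !mxE.
Qed.

Local Notation "X ^h" := (map_mx Num.conj X^T) (at level 2, format "X ^h").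

Let hM (p q r : nat) (X : 'M[R[i]]_(p, q)) (Y : 'M[R[i]]_(q, r)) :
  (X *m Y)^h = Y^h *m X^h.
Proof. by rewrite trmx_mul map_mxM. Qed.

Let Mexp_adj (a lambda : 'cV[R]_n) (x : 'cV[R[i]]_n) :
  (Mexp a lambda)^h *m x = \col_k (c^* * hdot x (endval a (texp (lambda k 0)))).
Proof.
apply/matrixP => k z; rewrite (ord1 z) [RHS]mxE mulr_sumr !mxE; apply: eq_bigr => j _.
by rewrite 2!mxE MexpE rmorphM /=; ring.
Qed.

Section Points.
Variable lambda : 'cV[R]_n.
Hypotheses (hl : forall j, Lambda (lambda j 0)) (uM : Mexp alpha lambda \in unitmx).
Let B := Mexp beta lambda *m invmx (Mexp alpha lambda).

Let BM : B *m Mexp alpha lambda = Mexp beta lambda.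
Proof. by rewrite /B mulmxKV. Qed.

Let gram : (Mexp beta lambda)^h *m Mexp beta lambda =
  (Mexp alpha lambda)^h *m Mexp alpha lambda.
Proof.
apply/matrixP => k l.
have colE (a : 'cV[R]_n) : col l ((Mexp a lambda)^h *m Mexp a lambda) =
    \col_k (c^* * (c * hdot (endval a (texp (lambda l 0))) (endval a (texp (lambda k 0))))).
  rewrite colE -mulmxA -colE Mexp_adj; apply/matrixP => i j; rewrite !mxE; congr (_ * _).
  by rewrite mulr_sumr; apply: eq_bigr => x _; rewrite mxE MexpE mulrA.
have := congr1 (fun M : 'cV_n => M k 0) (colE alpha).
have := congr1 (fun M : 'cV_n => M k 0) (colE beta).
by rewrite !(mxE _ _ k 0) => -> ->; rewrite basis_hdot.
Qed.

Let BhB : B^h *m B = 1%:M.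
Proof.
rewrite /B hM -mulmxA (mulmxA (Mexp beta lambda)^h) gram.
by rewrite -mulmxA mulmxV // mulmx1 -hM mulmxV // trmx1 map_mx1.
Qed.

Lemma basis_unitary : B \is unitarymx.
Proof. by apply/unitarymxP; exact: mulmx1C BhB. Qed.

(** At the points of [lambda] this is the definition of [B]. For any other [t] in [Lambda], both
    sides have the same inner products with the columns of [Mexp beta lambda], which form a
    basis. *)
Lemma basis_boundary t : Lambda t ->
  B *m endval alpha (texp t) = endval beta (texp t).
Proof.
move=> ht.
have ub : (Mexp beta lambda)^h \in unitmx.
  rewrite map_unitmx unitmx_tr -BM unitmx_mul uM andbT.
  by have /mulmx1_unit [] := BhB.
have e1 : (Mexp beta lambda)^h *m B = (Mexp alpha lambda)^h.
  by rewrite -{1}BM hM -mulmxA BhB mulmx1.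
apply/eqP; rewrite -subr_eq0; apply/eqP.
rewrite -[LHS](mulKmx ub) mulmxBr mulmxA e1.
rewrite !Mexp_adj (_ : _ - _ = 0) ?mulmx0 //.
by apply/matrixP => k z; rewrite !mxE basis_hdot // subrr.
Qed.

(** The form is only semidefinite, but a mode is determined by its value at one interior point of
    each interval. *)
Lemma sqn_tmode_eq0 z (v : 'cV[R[i]]_n) : sqn (tmode z v) = 0 -> v = 0.
Proof.
rewrite sqn_sum => h; apply/matrixP => j k; rewrite (ord1 k) mxE.
have hj := psumr_eq0P (fun j _ => Re_cint_ge0 alpha beta (tmode z v) j) h (isT : xpredT j).
have := @cint_sqmod_eq0 _ _ _ _ ((alpha j 0 + beta j 0) / 2) (alpha_lt_beta j)
  (@tcont_tmode R n z v j) (hj j).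
have := alpha_lt_beta j => ab.
have -> : alpha j 0 < (alpha j 0 + beta j 0) / 2 < beta j 0 by apply/andP; split; lra.
move=> /(_ isT)/eqP; rewrite /tmode mulf_eq0 => /orP[/eqP //|/eqP e].
have := cexpNK (two_pi_i R * z * ((alpha j 0 + beta j 0) / 2)%:C).
by rewrite e mulr0 => /esym/eqP; rewrite oner_eq0.
Qed.

Lemma basis_spectral : spectral_mx alpha beta B.
Proof.
move=> z K.
have KP v : K v <-> B *m endval alpha (tmode z v) = endval beta (tmode z v).
  exact: ker_spectralP.
(* By parts, [2 pi i (z - t) <mode, e_t> = 0]. Only the real [t] gets conjugated, so complex [z] is
   covered. *)
have orth v t : K v -> Lambda t -> t%:C != z -> tip (tmode z v) (texp t) = 0.
  move=> /KP kv ht tz; have ct := Se t; have cv := @tcont_tmode R n z v.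
  have := tip_by_parts alpha_lt_beta (@tderiv_tmode R n z v) (@tderiv_texp R n t)
    (phZ TP _ cv) (phZ TP _ ct).
  rewrite bdryE -kv -basis_boundary // hdot_unitary ?basis_unitary // subrr.
  rewrite (ipZl TP) // (ipZr TP) // rmorphM /= two_pi_iJ.
  rewrite conjC_real.
  rewrite !mulNr -mulrBl -mulrBr => /eqP.
  rewrite !mulf_eq0 (negbTE (two_pi_i_neq0 R)) subr_eq0 eq_sym (negbTE tz) /=.
  by move/eqP.
have [[t [ht tz]]|nt] := pselect (exists t, Lambda t /\ t%:C = z).
  right; apply/seteqP; split => v.
    move=> kv; have cv := @tcont_tmode R n z v; have ct := Se t.
    (* Removing the component along [texp t] leaves a mode of the same frequency that is orthogonal
       to the whole basis. *)
    pose d := tip (tmode z v) (texp t) / m%:C.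
    have mC : m%:C != 0 :> R[i] by rewrite (inj_eq (@complexI R)) gt_eqF.
    have cd : tcont (d *: texp t) by exact: (phZ TP).
    exists d => //; apply/esym/eqP; rewrite -subr_eq0; apply/eqP; apply: (@sqn_tmode_eq0 z).
    have -> : tmode z (v - d *: const_mx 1) = tmode z v - d *: texp t.
      rewrite texpE tz; apply: funext => j; apply: funext => x.
      have -> : (tmode z v - d *: tmode z (const_mx 1)) j x =
        tmode z v j x - d * tmode z (const_mx 1) j x by [].
      by rewrite /tmode !mxE; ring.
    apply: basis_complete; first exact: (phB TP).
    move=> s hs; have cs := Se s; rewrite (ipBl TP) // (ipZl TP) //.
    have [<-|ts] := eqVneq t s; first by rewrite tipt divfK // subrr.
    rewrite basis_orth // mulr0 subr0 orth //.
    by rewrite -tz (inj_eq (@complexI R)) eq_sym.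
  move=> [d _ <-]; have k1 : K (const_mx 1).
    by apply/KP; rewrite -tz -texpE; exact: basis_boundary.
  by rewrite /K /ker_cV /= -scalemxAr (k1 : _ *m _ = 0) scaler0.
left; apply/seteqP; split => v; last by move=> ->; rewrite /K /ker_cV /= mulmx0.
move=> kv; apply: (@sqn_tmode_eq0 z); apply: basis_complete; first exact: tcont_tmode.
by move=> t ht; apply: orth => //; apply/eqP => e; apply: nt; exists t.
Qed.

End Points.
End Forward.

Theorem theorem4p12 (R : realType) (n : nat) (alpha beta : 'cV[R]_n)
    (n_gt0 : (0 < n)%N)
    (alpha_lt_beta : forall i : 'I_n, alpha i 0 < beta i 0)
    (beta_lt_alpha : forall i j : 'I_n, j = i.+1 :> nat ->
       beta i 0 < alpha j 0) :
  spectral_set (interval_union alpha beta) <->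
  exists lambda : 'cV[R]_n,
    Mexp alpha lambda \in unitmx /\
    let B := Mexp beta lambda *m invmx (Mexp alpha lambda) in
    B \is unitarymx /\ spectral_mx alpha beta B.
Proof.
split=> [[Lambda basis]|[lambda [_ /= [uB spB]]]]; last first.
  exists (spectrum alpha beta (Mexp beta lambda *m invmx (Mexp alpha lambda))).
  exact: spectrum_orthonormal_basis.
have [lambda hl uM] := basis_points n_gt0 alpha_lt_beta beta_lt_alpha basis.
exists lambda; split=> //=; split; first exact: (basis_unitary _ _ _ basis).
exact: (basis_spectral _ _ _ basis).
Qed.
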